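(* Let $\omega=(\tilde\omega,\omega_d)\in\mathbb R^d$, $d\geq3$, be non-resonant with $\tilde\omega\in\mathbb R^{d-1}$ such that there is a sequence $\{\bar k_j\}\subset\mathbb Z^{d-1}$ with $\lim_{j\to\infty}\frac{\ln|\langle\tilde\omega,\bar k_j\rangle|}{\|\bar k_j\|}=-\infty$. There exists a real entire Hamiltonian $H$ on $\mathbb{T}^d\times\mathbb R^d$ of the form $H(\theta,r)=\langle\omega,r\rangle+\mathcal O(r^2)$ such that for every $(\theta,r)\in\mathbb{T}^d\times\mathbb R^d$ with $r_d\neq0$, $\limsup_{t\to\infty}|\Phi^t_H(\theta,r)|=\infty$. The Birkhoff normal form of $H$ at $\mathcal{T}_0=\mathbb{T}^d\times\{0\}$ is $N(r)=\langle\omega,r\rangle$.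
   Context: $\|k\|=\max_m|k_m|$; non-resonant means rationally independent coordinates. Real entire: extends holomorphically to $(\mathbb C/\mathbb Z)^d\times\mathbb C^d$, real on real arguments. $\Phi^t_H$ is the Hamiltonian flow for $d\theta\wedge dr$. Birkhoff normal form: formal power series $N_H(r)$ such that some formal series $f(\theta,r)=\sum_j a_j(\theta)r^j=\mathcal O(r^2)$ with coefficients real analytic near $\mathbb{T}^d$ satisfies $H(\theta,r+\partial_\theta f(\theta,r))=N_H(r)$. *)

(* Defs.v *)
From Stdlib Require Import Reals ZArith.
From Coquelicot Require Import Coquelicot.
From mathcomp Require Import ssreflect ssrbool eqtype ssrnat fintype finfun bigop.

Set Implicit Arguments.
Unset Strict Implicit.
Unset Printing Implicit Defensive.

Open Scope R_scope.

Section Defs.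
Variable d : nat.

Definition upd {T : Type} (x : 'I_d -> T) (i : 'I_d) (u : T) : 'I_d -> T :=
  fun j => if j == i then u else x j.

Definition dotR (w r : 'I_d -> R) : R := \big[Rplus/0]_(i < d) (w i * r i).

Definition supnorm (x : 'I_d -> R) : R := \big[Rmax/0]_(i < d) Rabs (x i).

Definition zvec (k : 'I_d -> Z) : 'I_d -> R := fun i => IZR (k i).

Definition znorm (k : 'I_d -> Z) : R := supnorm (zvec k).

Definition nonresonant (w : 'I_d -> R) : Prop :=
  forall k : 'I_d -> Z, (exists i, k i <> 0%Z) -> dotR w (zvec k) <> 0.

Definition liouville_seq (w : 'I_d -> R) : Prop :=
  exists kbar : nat -> ('I_d -> Z),
    is_lim_seq (fun j => ln (Rabs (dotR w (zvec (kbar j)))) / znorm (kbar j))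
               m_infty.

Definition cvec (x : 'I_d -> R) : 'I_d -> C := fun i => RtoC (x i).

Definition cdist (z y : 'I_d -> C) (delta : R) : Prop :=
  forall i, Cmod (y i - z i) < delta.

Definition holo_on (U : ('I_d -> C) -> Prop) (G : ('I_d -> C) -> C) : Prop :=
  (forall z, U z -> forall eps, 0 < eps -> exists delta, 0 < delta /\
       forall y, cdist z y delta -> Cmod (G y - G z) < eps) /\
  (forall z i, U z ->
       ex_derive (K := C_AbsRing) (V := C_NormedModule)
                 (fun u => G (upd z i u)) (z i)).

Definition entire2 (F : ('I_d -> C) -> ('I_d -> C) -> C) : Prop :=
  (forall z w eps, 0 < eps -> exists delta, 0 < delta /\
       forall z' w', cdist z z' delta -> cdist w w' delta ->
         Cmod (F z' w' - F z w) < eps) /\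
  (forall z w i,
       ex_derive (K := C_AbsRing) (V := C_NormedModule)
                 (fun u => F (upd z i u) w) (z i)) /\
  (forall z w i,
       ex_derive (K := C_AbsRing) (V := C_NormedModule)
                 (fun u => F z (upd w i u)) (w i)).

(* A function H(theta, r) on T^d x R^d (theta lifted to R^d) is real entire:
   it extends to a holomorphic function F on (C/Z)^d x C^d (i.e. holomorphic
   on C^d x C^d and 1-periodic in each theta_i), real on real arguments, with
   F = H on real arguments. *)
Definition real_entire (H : ('I_d -> R) -> ('I_d -> R) -> R) : Prop :=
  exists F : ('I_d -> C) -> ('I_d -> C) -> C,
    entire2 F /\
    (forall z w i, F (upd z i (z i + 1)%C) w = F z w) /\
    (forall th r, F (cvec th) (cvec r) = RtoC (H th r)).

Definition real_analytic_torus (a : ('I_d -> R) -> R) : Prop :=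
  exists rho, 0 < rho /\
  exists G : ('I_d -> C) -> C,
    holo_on (fun z => forall i, Rabs (Im (z i)) < rho) G /\
    (forall z i, G (upd z i (z i + 1)%C) = G z) /\
    (forall th, G (cvec th) = RtoC (a th)).

Definition mdeg (j : 'I_d -> nat) : nat := \sum_(i < d) j i.

Definition monom (r : 'I_d -> R) (j : 'I_d -> nat) : R :=
  \big[Rmult/1]_(i < d) (r i ^ j i).

(* sum of c j over all multi-indices j in N^d with |j| <= n
   (each such j is enumerated exactly once, as a map 'I_d -> 'I_n.+1) *)
Definition trunc_sum (n : nat) (c : ('I_d -> nat) -> R) : R :=
  \big[Rplus/0]_(j : {ffun 'I_d -> 'I_n.+1} | (mdeg (fun i => nat_of_ord (j i)) <= n)%N)
     c (fun i => nat_of_ord (j i)).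

Definition trunc_series (a : ('I_d -> nat) -> ('I_d -> R) -> R) (n : nat)
    (th r : 'I_d -> R) : R :=
  trunc_sum n (fun j => a j th * monom r j).

Definition dth (g : ('I_d -> R) -> ('I_d -> R) -> R) (i : 'I_d) th r : R :=
  Derive (fun u => g (upd th i u) r) (th i).
Definition dr (g : ('I_d -> R) -> ('I_d -> R) -> R) (i : 'I_d) th r : R :=
  Derive (fun u => g th (upd r i u)) (r i).

Definition vadd (x y : 'I_d -> R) : 'I_d -> R := fun i => x i + y i.

Definition bigO_at0 (g : ('I_d -> R) -> R) (m : nat) : Prop :=
  exists C delta, 0 < delta /\
    forall r, supnorm r < delta -> Rabs (g r) <= C * supnorm r ^ m.

(* N is the Birkhoff normal form of H at T^d x {0}: there is a formal series
   f(theta,r) = sum_j a_j(theta) r^j = O(r^2) with coefficients a_j real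
   analytic on T^d such that H(theta, r + d_theta f(theta,r)) = N(r) as formal
   power series in r.  The formal identity is expressed order by order: for
   every n, replacing f by its truncation f_{<=n}, the difference
   H(theta, r + d_theta f_{<=n}(theta,r)) - N(r) is O(|r|^(n+1)).
   (N is given here as a function; it is used for a polynomial N.) *)
Definition is_BNF (H : ('I_d -> R) -> ('I_d -> R) -> R) (N : ('I_d -> R) -> R)
    : Prop :=
  exists a : ('I_d -> nat) -> ('I_d -> R) -> R,
    (forall j, (mdeg j < 2)%nat -> forall th, a j th = 0) /\
    (forall j, real_analytic_torus (a j)) /\
    (forall (n : nat) th,
       bigO_at0 (fun r =>
          H th (vadd r (fun i => dth (trunc_series a n) i th r)) - N r) n.+1).

(* (Th, Rr) : [0,oo) -> R^d x R^d is a solution of Hamilton's equations for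
   the symplectic form d theta /\ d r:  theta' = dH/dr,  r' = - dH/dtheta,
   for t > 0, continuous from the right at t = 0. *)
Definition ham_sol (H : ('I_d -> R) -> ('I_d -> R) -> R)
    (Th Rr : R -> ('I_d -> R)) : Prop :=
  (forall t, 0 < t -> forall i,
      is_derive (fun s => Th s i) t (dr H i (Th t) (Rr t)) /\
      is_derive (fun s => Rr s i) t (- dth H i (Th t) (Rr t))) /\
  (forall i, filterlim (fun s => Th s i) (at_right 0) (locally (Th 0 i)) /\
             filterlim (fun s => Rr s i) (at_right 0) (locally (Rr 0 i))).

Definition lastc (x : 'I_d -> R) : R :=
  match @insub nat (fun k => (k < d)%N) _ d.-1 with Some i => x i | None => 0 end.

End Defs.

Definition vtilde (d : nat) (w : 'I_d -> R) : 'I_d.-1 -> R :=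
  fun i => w (widen_ord (leq_pred d) i).

(* Main.v *)
(* Let K_n be integer vectors with vanishing last coordinate along which
   e_n ^ 2 = |<w, K_n>| tends to 0 super-exponentially in |K_n|, and put
     H(th, r) = <w, r> + sum_n e_n * r_d ^ (n + 2) * sin (2 pi <K_n, th>).
   Since e_n is itself super-exponentially small, H is entire; r_d is a first
   integral and the first d - 1 angles move linearly.  Formally, H is conjugated
   to <w, r> by
     f = sum_n e_n / (2 pi <w, K_n>) * r_d ^ (n + 2) * cos (2 pi <K_n, th>),
   whose coefficients are trigonometric monomials, although the series diverges
   like r_d ^ (n + 2) / e_n.  Along a solution with r_d <> 0, at a time of order
   1 / |<w, K_n>|, the n-th term has displaced r by at least
   |r_d| ^ (n + 2) / e_n; if the e_n are sufficiently lacunary, the earlier terms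
   contribute much less than that and the later ones a bounded amount. *)
From HB Require Import structures.
Require Import Defs.
From Stdlib Require Import Reals ZArith Lra Lia FunctionalExtensionality IndefiniteDescription.
From Coquelicot Require Import Coquelicot.
From mathcomp Require Import ssreflect ssrfun ssrbool eqtype ssrnat seq fintype finfun bigop.
Open Scope R_scope.

(** * Complex exponentials and powers with quadratic remainders *)

(** Taking e_n to be the square root of the divisor reconciles two opposite demands: the amplitude
    e_n must beat every exponential of n + |K_n| for H to be entire, while amplitude over divisor,
    which is 1 / e_n up to a constant, must blow up. The power r_d ^ (n + 2) gives each harmonic an
    order of its own, so no coefficient of f collects infinitely many terms. Since K_n has no last
    component, f does not depend on th_d; the substitution r + d_th f leaves r_d alone, and
    truncating f leaves exactly a tail of the perturbation, with no further error terms. A small r_d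
    could damp the growth through r_d ^ (n + 2). Hence e_n is required to lie below exp (- n (n + 1
    + |K_n|)), whose exponent is at least quadratic in n, whereas ln |r_d| ^ (n + 2) is only linear
    in n. The growth is claimed for every solution of the equations, so it is derived from the
    equations themselves and not from an explicit formula combined with uniqueness. *)

Lemma Cmod_le_Rabs (z : C) : Cmod z <= Rabs (fst z) + Rabs (snd z).
Proof.
  case: z => x y /=; rewrite /Cmod /=.
  have Hx := Rabs_pos x; have Hy := Rabs_pos y.
  rewrite -(sqrt_Rsqr (Rabs x + Rabs y)); last lra.
  apply: sqrt_le_1_alt; rewrite /Rsqr.
  have : Rabs x * Rabs x = x * x by rewrite -Rabs_mult Rabs_pos_eq //; nra.
  have : Rabs y * Rabs y = y * y by rewrite -Rabs_mult Rabs_pos_eq //; nra.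
  nra.
Qed.

Lemma Rabs_fst_le_Cmod (z : C) : Rabs (fst z) <= Cmod z.
Proof. exact: Rle_trans (Rmax_l _ _) (Rmax_Cmod z). Qed.

Lemma Rabs_snd_le_Cmod (z : C) : Rabs (snd z) <= Cmod z.
Proof. exact: Rle_trans (Rmax_r _ _) (Rmax_Cmod z). Qed.

Lemma Cmod_sqr (z : C) : Cmod z ^ 2 = fst z ^ 2 + snd z ^ 2.
Proof. rewrite /Cmod pow2_sqrt //; have := pow2_ge_0 (fst z); have := pow2_ge_0 (snd z); lra. Qed.

(** Complex differentiability is always obtained from an explicit quadratic remainder on the unit
    disc, because such bounds can be summed term by term over a series. *)
Lemma is_derive_C_quadratic (f : C -> C) (x l : C) (B : R) :
  (forall h, Cmod h <= 1 -> Cmod (f (x + h) - f x - h * l)%C <= B * Cmod h ^ 2) ->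
  is_derive (K := C_AbsRing) (V := C_NormedModule) f x l.
Proof.
  move=> Hq; split; first exact: is_linear_scal_l.
  move=> y Hy eps.
  have E0 := is_filter_lim_locally_unique (K := C_AbsRing) (V := AbsRing_NormedModule C_AbsRing) x y Hy; subst y.
  have Heps := cond_pos eps.
  have HB : 0 < Rabs B + 1 by have := Rabs_pos B; lra.
  have Hd : 0 < Rmin 1 (eps / (Rabs B + 1)).
    by apply: Rmin_pos; [lra | apply: Rdiv_lt_0_compat].
  exists (mkposreal _ Hd) => /= u0; pose u : C := u0; rewrite -/u => Hu.
  set h := (u - x)%C.
  have Hh : Cmod h < Rmin 1 (eps / (Rabs B + 1)) by exact: Hu.
  have Hh1 := Rlt_le_trans _ _ _ Hh (Rmin_l _ _).
  have Hh2 := Rlt_le_trans _ _ _ Hh (Rmin_r _ _).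
  have E : @eq C u (x + h)%C by rewrite /h; move: (u) => v; ring.
  rewrite E; change (Cmod (f (x + h) - f x - (x + h - x) * l)%C <= eps * Cmod (x + h - x)%C).
  have -> : (x + h - x = h)%C by ring.
  apply: Rle_trans (Hq h _) _; first lra.
  have h0 := Cmod_ge_0 h.
  have Hb : Rabs B * Cmod h <= eps.
    apply: Rle_trans (_ : (Rabs B + 1) * Cmod h <= _); first nra.
    apply: Rle_trans (Rmult_le_compat_l _ _ _ (Rlt_le _ _ HB) (Rlt_le _ _ Hh2)) _.
    by apply: Req_le; field; lra.
  have := Rle_abs B; nra.
Qed.

(** Lets the real partial derivatives of the Hamiltonian be read off from those of its holomorphic
    extension, so that termwise differentiation is carried out only once. *)
Lemma is_derive_R_of_C (F : C -> C) (f : R -> R) (x : R) (l : C) :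
  is_derive (K := C_AbsRing) (V := C_NormedModule) F (RtoC x) l ->
  (forall u, F (RtoC u) = RtoC (f u)) -> is_derive f x (fst l).
Proof.
  move=> [_ HF] Hf; split; first exact: is_linear_scal_l.
  move=> y Hy eps.
  have E0 := is_filter_lim_locally_unique (K := R_AbsRing) (V := AbsRing_NormedModule R_AbsRing) x y Hy; subst y.
  case: (HF (RtoC x) (fun P HP => HP) eps) => d Hd.
  exists d => /= u Hu.
  have {}Hu : Cmod (RtoC u - RtoC x)%C < d by rewrite -RtoC_minus Cmod_R.
  have H : Cmod (F (RtoC u) - F (RtoC x) - (RtoC u - RtoC x) * l)%C <= eps * Cmod (RtoC u - RtoC x)%C.
    exact: Hd.
  change (Rabs (f u - f x - (u - x) * fst l) <= eps * Rabs (u - x)).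
  rewrite !Hf -!RtoC_minus Cmod_R in H.
  apply: Rle_trans H; apply: Rle_trans (Rabs_fst_le_Cmod _); apply: Req_le; congr Rabs.
  by rewrite /=; ring.
Qed.

Definition cexp (z : C) : C := (exp (fst z) * cos (snd z), exp (fst z) * sin (snd z)).

Lemma cexp_add (a b : C) : cexp (a + b)%C = (cexp a * cexp b)%C.
Proof.
  rewrite /cexp /= exp_plus cos_plus sin_plus /Cmult /=.
  by congr pair; ring.
Qed.

Lemma Cmod_cexp (z : C) : Cmod (cexp z) = exp (fst z).
Proof.
  have H := exp_pos (fst z).
  rewrite /Cmod /cexp /= -[RHS](sqrt_Rsqr) ?/Rsqr; last lra.
  congr sqrt; have := sin2_cos2 (snd z); rewrite /Rsqr => E.
  transitivity (exp (fst z) * exp (fst z) * (sin (snd z) * sin (snd z) + cos (snd z) * cos (snd z))).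
    ring.
  by rewrite E; ring.
Qed.

Lemma exp_le_mono (x y : R) : x <= y -> exp x <= exp y.
Proof. by case=> [/exp_increasing H|->]; lra. Qed.

Lemma one_le_exp (x : R) : 0 <= x -> 1 <= exp x.
Proof. by move=> H; rewrite -exp_0; apply: exp_le_mono. Qed.

Lemma Cmod_cexp_le (z : C) : Cmod (cexp z) <= exp (Cmod z).
Proof.
  rewrite Cmod_cexp; apply: exp_le_mono.
  exact: Rle_trans (Rle_abs _) (Rabs_fst_le_Cmod z).
Qed.

Lemma Rabs_exp_sub1_le (x : R) : Rabs (exp x - 1) <= Rabs x * exp (Rabs x).
Proof.
  have H1 := exp_ineq1_le x; have H2 := exp_ineq1_le (- x).
  have E : exp x * exp (- x) = 1 by rewrite -exp_plus Rplus_opp_r exp_0.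
  have Hp := exp_pos x.
  case: (Rle_dec 0 x) => Hx.
  - by rewrite (Rabs_pos_eq x) // Rabs_pos_eq; nra.
  - rewrite (Rabs_left x); last lra.
    have := one_le_exp (- x).
    rewrite Rabs_left1; nra.
Qed.

Lemma Rabs_exp_rem_le (x : R) : Rabs (exp x - 1 - x) <= x ^ 2 * exp (Rabs x).
Proof.
  have H1 := exp_ineq1_le x; have H2 := exp_ineq1_le (- x).
  have E : exp x * exp (- x) = 1 by rewrite -exp_plus Rplus_opp_r exp_0.
  have Hp := exp_pos x.
  have H3 := Rabs_exp_sub1_le x.
  rewrite Rabs_pos_eq; last lra.
  apply: Rle_trans (_ : x * (exp x - 1) <= _); first nra.
  apply: Rle_trans (Rle_abs _) _; rewrite Rabs_mult.
  have -> : x ^ 2 = Rabs x * Rabs x by rewrite -Rabs_mult Rabs_pos_eq; nra.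
  have := Rabs_pos x; nra.
Qed.

Lemma Rabs_sin_le (x : R) : Rabs (sin x) <= Rabs x.
Proof.
  case: (MVT_gen sin 0 x cos) => [y _|y _|c [_ H]].
  - exact: is_derive_sin.
  - exact: continuity_sin.
  - have -> : sin x = cos c * x by rewrite sin_0 in H; lra.
    rewrite Rabs_mult; have : Rabs (cos c) <= 1 by apply: Rabs_le; have := COS_bound c; lra.
    have := Rabs_pos x; nra.
Qed.

Lemma one_sub_cos (y : R) : 1 - cos y = 2 * sin (y / 2) ^ 2.
Proof.
  have {1}-> : y = 2 * (y / 2) by field.
  rewrite cos_2a_sin; ring.
Qed.

Lemma Rabs_cos_sub1_le2 (y : R) : Rabs (cos y - 1) <= y ^ 2.
Proof.
  have := one_sub_cos y; have H := Rabs_sin_le (y / 2).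
  have : sin (y / 2) ^ 2 <= (y / 2) ^ 2.
    rewrite -(pow2_abs (sin _)) -(pow2_abs (y / 2)).
    by apply: pow_incr; split => //; exact: Rabs_pos.
  have := COS_bound y.
  move=> A1 A2 A3; rewrite Rabs_left1; nra.
Qed.

Lemma Rabs_cos_sub1_le (y : R) : Rabs (cos y - 1) <= Rabs y.
Proof.
  case: (MVT_gen cos 0 y (fun x => - sin x)) => [x _|x _|c [_ H]].
  - exact: is_derive_cos.
  - exact: continuity_cos.
  - have -> : cos y - 1 = - sin c * y by rewrite cos_0 in H; lra.
    rewrite Rabs_mult Rabs_Ropp; have : Rabs (sin c) <= 1 by apply: Rabs_le; have := SIN_bound c; lra.
    have := Rabs_pos y; nra.
Qed.

Lemma Rabs_sin_rem_le (y : R) : Rabs (sin y - y) <= y ^ 2.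
Proof.
  case: (MVT_gen (fun x => sin x - x) 0 y (fun x => cos x - 1)) => [x _|x _|c [Hc H]].
  - by auto_derive => //; ring.
  - apply: continuity_pt_minus; first exact: continuity_sin.
    exact: derivable_continuous_pt (derivable_pt_id _).
  - have -> : sin y - y = (cos c - 1) * y by rewrite sin_0 in H; lra.
    rewrite Rabs_mult -(pow2_abs y).
    have := Rabs_cos_sub1_le c.
    have : Rabs c <= Rabs y.
      move: Hc; rewrite /Rmin /Rmax; case: Rle_dec => Hy Hc.
      - rewrite !Rabs_pos_eq; lra.
      - rewrite !Rabs_left1; lra.
    have := Rabs_pos y; nra.
Qed.

(** With h = x + i y, the real part of the remainder costs one |h|^2 and the imaginary part two,
    because |x| |y| <= x^2 + y^2; hence the factor 3. *)
Lemma cexp_rem0 (h : C) : Cmod (cexp h - 1 - h)%C <= 3 * Cmod h ^ 2 * exp (Cmod h).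
Proof.
  set x := fst h; set y := snd h.
  have Hx : Rabs x <= Cmod h := Rabs_fst_le_Cmod h.
  have He : exp (Rabs x) <= exp (Cmod h) by apply: exp_le_mono.
  have H1 : 1 <= exp (Rabs x) by apply: one_le_exp; exact: Rabs_pos.
  have Hre : Rabs (exp x * cos y - 1 - x) <= (x ^ 2 + y ^ 2) * exp (Rabs x).
    have -> : exp x * cos y - 1 - x = (exp x - 1 - x) * cos y + (1 + x) * (cos y - 1) by ring.
    apply: Rle_trans (Rabs_triang _ _) _; rewrite !Rabs_mult.
    have A1 := Rabs_exp_rem_le x; have A2 := Rabs_cos_sub1_le2 y.
    have A3 : Rabs (cos y) <= 1 by apply: Rabs_le; have := COS_bound y; lra.
    have A4 : Rabs (1 + x) <= exp (Rabs x).
      apply: Rle_trans (Rabs_triang _ _) _; rewrite Rabs_R1; exact: exp_ineq1_le.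
    have := Rabs_pos (1 + x); have := Rabs_pos (exp x - 1 - x).
    have := Rabs_pos (cos y); have := Rabs_pos (cos y - 1); nra.
  have Him : Rabs (exp x * sin y - y) <= (Rabs x * Rabs y + y ^ 2) * exp (Rabs x).
    have -> : exp x * sin y - y = (exp x - 1) * sin y + (sin y - y) by ring.
    apply: Rle_trans (Rabs_triang _ _) _; rewrite !Rabs_mult.
    have A1 := Rabs_exp_sub1_le x; have A2 := Rabs_sin_rem_le y.
    have A3 := Rabs_sin_le y.
    have := pow2_ge_0 y; have := Rabs_pos (exp x - 1); have := Rabs_pos (sin y).
    have := Rabs_pos x; have := Rabs_pos y.
    move=> *; have : Rabs (exp x - 1) * Rabs (sin y) <= (Rabs x * exp (Rabs x)) * Rabs y.
      by apply: Rmult_le_compat.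
    nra.
  apply: Rle_trans (Cmod_le_Rabs _) _.
  have -> : fst (cexp h - 1 - h)%C = exp x * cos y - 1 - x by rewrite /= /x /y; ring.
  have -> : snd (cexp h - 1 - h)%C = exp x * sin y - y by rewrite /= /x /y; ring.
  have E : Cmod h ^ 2 = x ^ 2 + y ^ 2 by exact: Cmod_sqr.
  have Hxy : Rabs x * Rabs y <= x ^ 2 + y ^ 2.
    rewrite -(pow2_abs x) -(pow2_abs y).
    have := pow2_ge_0 (Rabs x - Rabs y); have := pow2_ge_0 (Rabs x + Rabs y); nra.
  have : 0 <= Cmod h ^ 2 by exact: pow2_ge_0.
  have := pow2_ge_0 x; have := pow2_ge_0 y.
  rewrite E in Hxy *; nra.
Qed.

Lemma cexp_rem (a h : C) :
  Cmod (cexp (a + h) - cexp a - h * cexp a)%C <= 3 * Cmod h ^ 2 * exp (Cmod a + Cmod h).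
Proof.
  rewrite cexp_add.
  have -> : (cexp a * cexp h - cexp a - h * cexp a = cexp a * (cexp h - 1 - h))%C by ring.
  rewrite Cmod_mult exp_plus.
  have := Cmod_cexp_le a; have := cexp_rem0 h; have := Cmod_ge_0 (cexp a).
  have := Cmod_ge_0 (cexp h - 1 - h)%C.
  move=> *; apply: Rle_trans (_ : exp (Cmod a) * (3 * Cmod h ^ 2 * exp (Cmod h)) <= _).
    by apply: Rmult_le_compat.
  by apply: Req_le; ring.
Qed.

(* The entire extension of [p cos a + q sin a]; the derivative is [ctrig q (-p)]. *)
Definition ctrig (p q : R) (a : C) : C :=
  (((p / 2)%R, (- (q / 2))%R) * cexp (Ci * a) + ((p / 2)%R, (q / 2)%R) * cexp (- (Ci * a)))%C.

Lemma ctrig_R (p q x : R) : ctrig p q (RtoC x) = RtoC (p * cos x + q * sin x).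
Proof.
  rewrite /ctrig /cexp /RtoC /Cmult /Cplus /Copp /Ci /=.
  have -> : 0 * x - 1 * 0 = 0 by ring.
  have -> : 0 * 0 + 1 * x = x by ring.
  rewrite Ropp_0 exp_0 cos_neg sin_neg; congr pair; field.
Qed.

Lemma ctrig_periodic (p q : R) (a : C) (n : Z) :
  ctrig p q (a + RtoC (2 * PI * IZR n))%C = ctrig p q a.
Proof.
  have sc : forall (x : R), cos (x + 2 * PI * IZR n) = cos x /\ sin (x + 2 * PI * IZR n) = sin x.
    move=> x; case: (Z_le_gt_dec 0 n) => Hn.
    - have -> : x + 2 * PI * IZR n = x + 2 * INR (Z.to_nat n) * PI.
        by rewrite INR_IZR_INZ Z2Nat.id //; ring.
      by rewrite cos_period sin_period.
    - set y := x + _.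
      have -> : x = y + 2 * INR (Z.to_nat (- n)) * PI.
        rewrite INR_IZR_INZ Z2Nat.id; last lia.
        by rewrite opp_IZR /y; ring.
      by rewrite cos_period sin_period.
  have e1 : cexp (Ci * (a + RtoC (2 * PI * IZR n)))%C = cexp (Ci * a)%C.
    rewrite /cexp /=.
    have -> : 0 * (fst a + 2 * PI * IZR n) - 1 * (snd a + 0) = 0 * fst a - 1 * snd a by ring.
    have -> : 0 * (snd a + 0) + 1 * (fst a + 2 * PI * IZR n)
      = (0 * snd a + 1 * fst a) + 2 * PI * IZR n by ring.
    by case: (sc (0 * snd a + 1 * fst a)) => -> ->.
  have e2 : cexp (- (Ci * (a + RtoC (2 * PI * IZR n))))%C = cexp (- (Ci * a))%C.
    rewrite /cexp /=.
    have -> : - (0 * (fst a + 2 * PI * IZR n) - 1 * (snd a + 0)) = - (0 * fst a - 1 * snd a) by ring.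
    have -> : 0 * (snd a + 0) + 1 * (fst a + 2 * PI * IZR n)
      = (0 * snd a + 1 * fst a) + 2 * PI * IZR n by ring.
    by rewrite !cos_neg !sin_neg; case: (sc (0 * snd a + 1 * fst a)) => -> ->.
  by rewrite /ctrig e1 e2.
Qed.

Lemma Cmod_half_le (p q : R) : Rabs p <= 1 -> Rabs q <= 1 -> Cmod (p / 2, q / 2) <= 1.
Proof.
  move=> Hp Hq; apply: Rle_trans (Cmod_le_Rabs _) _ => /=.
  rewrite /Rdiv !Rabs_mult (Rabs_pos_eq (/ 2)); lra.
Qed.

Lemma Cmod_ctrig_le (p q : R) (a : C) :
  Rabs p <= 1 -> Rabs q <= 1 -> Cmod (ctrig p q a) <= 2 * exp (Cmod a).
Proof.
  move=> Hp Hq.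
  have E : Cmod (Ci * a)%C = Cmod a by rewrite Cmod_mult Cmod_Ci Rmult_1_l.
  have H1 : Cmod (p / 2, - (q / 2)) <= 1.
    have -> : - (q / 2) = (- q) / 2 by field.
    by apply: Cmod_half_le => //; rewrite Rabs_Ropp.
  have H2 := Cmod_half_le p q Hp Hq.
  apply: Rle_trans (Cmod_triangle _ _) _; rewrite !Cmod_mult.
  have := Cmod_cexp_le (Ci * a)%C; have := Cmod_cexp_le (- (Ci * a))%C.
  rewrite Cmod_opp E.
  have := Cmod_ge_0 (cexp (Ci * a)%C); have := Cmod_ge_0 (cexp (- (Ci * a))%C).
  nra.
Qed.

(** Differentiation multiplies the two exponential coefficients by i and -i, so the remainder splits
    into two remainders of [cexp], each with a coefficient of modulus at most 1; this gives 3 + 3 =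
    6. The passage from (p, q) to (q, -p) preserves the bounds on p and q. *)
Lemma ctrig_rem (p q : R) (a h : C) : Rabs p <= 1 -> Rabs q <= 1 ->
  Cmod (ctrig p q (a + h) - ctrig p q a - h * ctrig q (- p) a)%C
    <= 6 * Cmod h ^ 2 * exp (Cmod a + Cmod h).
Proof.
  move=> Hp Hq.
  set s := (((p / 2)%R, (- (q / 2))%R) : C); set s' := (((p / 2)%R, (q / 2)%R) : C).
  have Es : (((q / 2)%R, (- (- p / 2))%R) : C) = (s * Ci)%C.
    by rewrite /s /Cmult /Ci /=; congr pair; field.
  have Es' : (((q / 2)%R, (- p / 2)%R) : C) = (- (s' * Ci))%C.
    by rewrite /s' /Cmult /Copp /Ci /=; congr pair; field.
  have E : forall a, Cmod (Ci * a)%C = Cmod a by move=> b; rewrite Cmod_mult Cmod_Ci Rmult_1_l.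
  have H1 : Cmod s <= 1.
    rewrite /s; have -> : - (q / 2) = (- q) / 2 by field.
    by apply: Cmod_half_le => //; rewrite Rabs_Ropp.
  have H2 : Cmod s' <= 1 := Cmod_half_le p q Hp Hq.
  have R1 := cexp_rem (Ci * a)%C (Ci * h)%C.
  have R2 := cexp_rem (- (Ci * a))%C (- (Ci * h))%C.
  rewrite !Cmod_opp !E in R1 R2.
  have -> : (ctrig p q (a + h) - ctrig p q a - h * ctrig q (- p) a)%C =
     (s * (cexp (Ci * a + Ci * h) - cexp (Ci * a) - Ci * h * cexp (Ci * a)) +
      s' * (cexp (- (Ci * a) + - (Ci * h)) - cexp (- (Ci * a)) - - (Ci * h) * cexp (- (Ci * a))))%C.
    rewrite /ctrig Es Es' -/s -/s'.
    have -> : (Ci * (a + h) = Ci * a + Ci * h)%C by ring.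
    have -> : (- (Ci * a + Ci * h) = - (Ci * a) + - (Ci * h))%C by ring.
    ring.
  apply: Rle_trans (Cmod_triangle _ _) _; rewrite !Cmod_mult.
  set X := Cmod (_ - _ - _)%C in R1 *; set Y := Cmod (_ - _ - _)%C in R2 *.
  have : 0 <= X by exact: Cmod_ge_0.
  have : 0 <= Y by exact: Cmod_ge_0.
  nra.
Qed.

Lemma INR_le_pow2 (m : nat) : INR m <= 2 ^ m.
Proof.
  elim: m => [|k IHk]; first by rewrite /=; lra.
  rewrite S_INR /=; have := pow_R1_Rle 2 k; lra.
Qed.

(** Induction on m: the next remainder is (w + h) times the previous one plus h^2 m w^(m-1). The
    base |w| + 1 dominates |w + h|, and the factor 2^m absorbs m. At m = 0 the truncated exponent is
    harmless, being multiplied by 0. *)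
Lemma Cpow_rem (w h : C) (m : nat) : Cmod h <= 1 ->
  Cmod ((w + h) ^ m - w ^ m - h * (INR m * w ^ m.-1))%C
    <= Cmod h ^ 2 * (2 * (Cmod w + 1)) ^ m.
Proof.
  move=> Hh; set c := Cmod w + 1.
  have w0 := Cmod_ge_0 w; have h0 := Cmod_ge_0 h.
  have Hc : 1 <= c by rewrite /c; lra.
  elim: m => [|m IH].
    have -> : ((w + h) ^ 0 - w ^ 0 - h * (INR 0 * w ^ 0.-1) = 0)%C by rewrite /=; ring.
    rewrite Cmod_0 /=; nra.
  set r := ((w + h) ^ m - w ^ m - h * (INR m * w ^ m.-1))%C in IH.
  have -> : ((w + h) ^ m.+1 - w ^ m.+1 - h * (INR m.+1 * w ^ m.+1.-1))%C
     = ((w + h) * r + h * h * (INR m * w ^ m.-1))%C.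
    have E : (INR m.+1 = INR m + 1 :> C)%C by rewrite S_INR RtoC_plus.
    have E2 : (INR m * (w * w ^ m.-1) = INR m * w ^ m)%C.
      by case: m {IH r E} => [|m] /=; ring.
    rewrite E /r !Cpow_S /= .
    transitivity ((w + h) * (w + h) ^ m - w * w ^ m - h * w ^ m
       - h * (INR m * (w * w ^ m.-1)) )%C; first by rewrite E2; ring.
    by ring.
  apply: Rle_trans (Cmod_triangle _ _) _; rewrite !Cmod_mult.
  have A1 : Cmod (w + h)%C <= c by apply: Rle_trans (Cmod_triangle _ _) _; rewrite /c; lra.
  have A2 : Cmod (INR m) <= 2 ^ m.
    by rewrite Cmod_R Rabs_pos_eq; [exact: INR_le_pow2 | exact: pos_INR].
  have A3 : Cmod (w ^ m.-1)%C <= c ^ m.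
    rewrite Cmod_pow.
    apply: Rle_trans (_ : c ^ m.-1 <= _); first by apply: pow_incr; rewrite /c; lra.
    by apply: Rle_pow => //; lia.
  have A4 : 0 <= Cmod (INR m) := Cmod_ge_0 _.
  have A5 : 0 <= Cmod (w ^ m.-1)%C := Cmod_ge_0 _.
  have A6 : Cmod (w + h)%C * Cmod r <= c * (Cmod h ^ 2 * (2 * c) ^ m).
    by apply: Rmult_le_compat => //; exact: Cmod_ge_0.
  have A7 : Cmod (INR m) * Cmod (w ^ m.-1)%C <= 2 ^ m * c ^ m by apply: Rmult_le_compat.
  rewrite Rpow_mult_distr in A6.
  have P2 : 0 < 2 ^ m by apply: pow_lt; lra.
  have Pc : 0 < c ^ m by apply: pow_lt; lra.
  have A8 : Cmod h * Cmod h * (Cmod (INR m) * Cmod (w ^ m.-1)%C) <= Cmod h * Cmod h * (2 ^ m * (c * c ^ m)).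
    apply: Rmult_le_compat_l; first nra.
    have A9 : 0 <= 2 ^ m * c ^ m by nra.
    apply: Rle_trans A7 _; nra.
  rewrite Rpow_mult_distr /=; nra.
Qed.

(** * Dominated series and linear forms *)

Lemma ex_series_dom (u b : nat -> R) :
  (forall n, Rabs (u n) <= b n) -> ex_series b -> ex_series u.
Proof. by move=> Hub; apply: ex_series_le. Qed.

Lemma Series_dom (u b : nat -> R) :
  (forall n, Rabs (u n) <= b n) -> ex_series b -> Rabs (Series u) <= Series b.
Proof.
  move=> Hub Hb; apply: Rle_trans (Series_Rabs _ _) _.
    by apply: ex_series_dom Hb => n; rewrite Rabs_Rabsolu.
  by apply: Series_le => // n; split => //; exact: Rabs_pos.
Qed.

Definition CSeries (u : nat -> C) : C :=
  (Series (fun n => fst (u n)), Series (fun n => snd (u n))).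

Lemma CSeries_ext (u v : nat -> C) : (forall n, u n = v n) -> CSeries u = CSeries v.
Proof. by move=> H; rewrite /CSeries; congr pair; apply: Series_ext => n; rewrite H. Qed.

Lemma ex_series_fst (u : nat -> C) (b : nat -> R) :
  (forall n, Cmod (u n) <= b n) -> ex_series b -> ex_series (fun n => fst (u n)).
Proof. by move=> H; apply: ex_series_dom => n; apply: Rle_trans (Rabs_fst_le_Cmod _) _. Qed.

Lemma ex_series_snd (u : nat -> C) (b : nat -> R) :
  (forall n, Cmod (u n) <= b n) -> ex_series b -> ex_series (fun n => snd (u n)).
Proof. by move=> H; apply: ex_series_dom => n; apply: Rle_trans (Rabs_snd_le_Cmod _) _. Qed.

Lemma CSeries_dom (u : nat -> C) (b : nat -> R) :
  (forall n, Cmod (u n) <= b n) -> ex_series b -> Cmod (CSeries u) <= 2 * Series b.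
Proof.
  move=> H Hb; apply: Rle_trans (Cmod_le_Rabs _) _ => /=.
  have := @Series_dom (fun n => fst (u n)) b; have := @Series_dom (fun n => snd (u n)) b.
  move=> H1 H2.
  have := H1 (fun n => Rle_trans _ _ _ (Rabs_snd_le_Cmod _) (H n)) Hb.
  have := H2 (fun n => Rle_trans _ _ _ (Rabs_fst_le_Cmod _) (H n)) Hb.
  lra.
Qed.

Lemma CSeries_minus (u v : nat -> C) (b c : nat -> R) :
  (forall n, Cmod (u n) <= b n) -> (forall n, Cmod (v n) <= c n) ->
  ex_series b -> ex_series c ->
  CSeries (fun n => u n - v n)%C = (CSeries u - CSeries v)%C.
Proof.
  move=> Hu Hv Hb Hc.
  rewrite /CSeries /Cminus /Cplus /Copp /=; congr pair; rewrite -Series_opp -Series_plus //.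
  - exact: ex_series_fst Hu Hb.
  - exact: ex_series_opp (ex_series_fst _ _ Hv Hc).
  - exact: ex_series_snd Hu Hb.
  - exact: ex_series_opp (ex_series_snd _ _ Hv Hc).
Qed.

Lemma CSeries_scal (h : C) (u : nat -> C) (b : nat -> R) :
  (forall n, Cmod (u n) <= b n) -> ex_series b ->
  CSeries (fun n => h * u n)%C = (h * CSeries u)%C.
Proof.
  move=> Hu Hb.
  have H1 := ex_series_fst _ _ Hu Hb; have H2 := ex_series_snd _ _ Hu Hb.
  have S : forall a v, ex_series v -> ex_series (fun n => a * v n).
    by move=> a v; exact: ex_series_scal_l.
  rewrite /CSeries /Cmult /=; congr pair; rewrite -!Series_scal_l -?Series_minus -?Series_plus //;
    exact: S.
Qed.

(** Termwise differentiation without a theorem on uniform limits: summable constants [B n] turn the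
    quadratic remainders of the terms into one for the sum. *)
Lemma is_derive_CSeries (f : nat -> C -> C) (x : C) (l : nat -> C) (b c B : nat -> R) :
  (forall n h, Cmod h <= 1 -> Cmod (f n (x + h)%C) <= b n) ->
  (forall n, Cmod (l n) <= c n) ->
  (forall n h, Cmod h <= 1 -> Cmod (f n (x + h) - f n x - h * l n)%C <= B n * Cmod h ^ 2) ->
  ex_series b -> ex_series c -> ex_series B ->
  is_derive (K := C_AbsRing) (V := C_NormedModule) (fun u => CSeries (fun n => f n u)) x (CSeries l).
Proof.
  move=> Hf Hl Hr Hb Hc HB.
  apply: (@is_derive_C_quadratic _ _ _ (2 * Series B)) => h Hh.
  have Hf0 : forall n, Cmod (f n x) <= b n.
    move=> n; have -> : x = (x + 0)%C by ring.
    by apply: Hf; rewrite Cmod_0; lra.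
  have Hf1 := fun n => Hf n h Hh.
  have Hbb : ex_series (fun n => b n + b n) by exact: ex_series_plus.
  have Hhc : ex_series (fun n => Cmod h * c n) by exact: ex_series_scal_l.
  rewrite -(CSeries_scal h l c) // -(CSeries_minus _ _ b b) //.
  rewrite -(CSeries_minus _ _ (fun n => b n + b n) (fun n => Cmod h * c n)) //.
  - have -> : 2 * Series B * Cmod h ^ 2 = 2 * Series (fun n => B n * Cmod h ^ 2).
      rewrite Series_scal_r; ring.
    apply: CSeries_dom; first by move=> n; exact: Hr.
    by apply: ex_series_scal_r.
  - move=> n; apply: Rle_trans (Cmod_triangle _ _) _; rewrite Cmod_opp; exact: Rplus_le_compat.
  - move=> n; rewrite Cmod_mult; apply: Rmult_le_compat_l => //; exact: Cmod_ge_0.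
Qed.

Lemma Rplus_left_id : left_id 0 Rplus. Proof. exact: Rplus_0_l. Qed.
HB.instance Definition _ := Monoid.isComLaw.Build R 0 Rplus
  (fun x y z => esym (Rplus_assoc x y z)) Rplus_comm Rplus_left_id.
Lemma Rmult_left_id : left_id 1 Rmult. Proof. exact: Rmult_1_l. Qed.
HB.instance Definition _ := Monoid.isComLaw.Build R 1 Rmult
  (fun x y z => esym (Rmult_assoc x y z)) Rmult_comm Rmult_left_id.

Lemma sumR_ge0 (I : Type) (r : seq I) (P : pred I) (F : I -> R) :
  (forall i, 0 <= F i) -> 0 <= \big[Rplus/0]_(i <- r | P i) F i.
Proof. by move=> H; elim/big_rec: _ => [|i a _ Ha]; [lra|have := H i; lra]. Qed.

Section Vectors.
Context {d : nat}.
Implicit Types (v x y : 'I_d -> R) (z : 'I_d -> C).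

Lemma upd_same {T : Type} (x : 'I_d -> T) i (u : T) : upd x i u i = u.
Proof. by rewrite /upd eqxx. Qed.

Lemma upd_other {T : Type} (x : 'I_d -> T) i j (u : T) : j != i -> upd x i u j = x j.
Proof. by rewrite /upd => /negbTE ->. Qed.

Lemma dotR_plus v x y : dotR v (fun i => x i + y i) = dotR v x + dotR v y.
Proof. by rewrite /dotR -big_split; apply: eq_bigr => i _ /=; ring. Qed.

Lemma dotR_scal v (c : R) x : dotR v (fun i => c * x i) = c * dotR v x.
Proof.
  rewrite /dotR; elim/big_rec2: _ => [|i a b _ ->]; ring.
Qed.

Lemma dotR_sym v x : dotR v x = dotR x v.
Proof. by apply: eq_bigr => i _; exact: Rmult_comm. Qed.

Lemma dotR_upd v x i (u : R) : dotR v (upd x i u) = dotR v x + v i * (u - x i).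
Proof.
  rewrite /dotR (bigD1 i) //= [in RHS](bigD1 i) //= upd_same.
  rewrite (eq_bigr (fun j => v j * x j)); last by move=> j Hj; rewrite upd_other.
  ring.
Qed.

Definition l1norm v : R := \big[Rplus/0]_(i < d) Rabs (v i).

Lemma l1norm_ge0 v : 0 <= l1norm v.
Proof. by apply: sumR_ge0 => i; exact: Rabs_pos. Qed.

Lemma Rabs_le_l1norm v i : Rabs (v i) <= l1norm v.
Proof.
  rewrite /l1norm (bigD1 i) //=.
  rewrite -[X in X <= _]Rplus_0_r; apply: Rplus_le_compat_l.
  by apply: sumR_ge0 => j; exact: Rabs_pos.
Qed.

Lemma Rabs_dotR_le v x (X : R) : 0 <= X -> (forall i, Rabs (x i) <= X) -> Rabs (dotR v x) <= l1norm v * X.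
Proof.
  move=> HX Hx; rewrite /dotR /l1norm; elim/big_rec2: _ => [|i a b _ H].
    by rewrite Rabs_R0; lra.
  apply: Rle_trans (Rabs_triang _ _) _; rewrite Rabs_mult.
  have := Hx i; have := Rabs_pos (v i); nra.
Qed.

Lemma Rabs_le_supnorm x i : Rabs (x i) <= supnorm x.
Proof.
  rewrite /supnorm; elim: (index_enum _) (mem_index_enum i) => // j s IH.
  rewrite in_cons big_cons => /orP [/eqP <-|/IH H]; first exact: Rmax_l.
  exact: Rle_trans H (Rmax_r _ _).
Qed.

Definition cdot v z : C := (dotR v (fun i => fst (z i)), dotR v (fun i => snd (z i))).

Lemma cdot_cvec v x : cdot v (cvec x) = RtoC (dotR v x).
Proof.
  rewrite /cdot /RtoC; congr pair.
  rewrite /dotR; elim/big_rec: _ => // i a _ ->; rewrite /=; ring.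
Qed.

Lemma cdot_upd v z i (u : C) : cdot v (upd z i u) = (cdot v z + (u - z i) * RtoC (v i))%C.
Proof.
  have E : forall (g : C -> R), (fun j => g (upd z i u j)) = upd (fun j => g (z j)) i (g u).
    by move=> g; apply: functional_extensionality => j; rewrite /upd; case: eqP.
  rewrite /cdot (E fst) (E snd) !dotR_upd /Cplus /Cmult /Cminus /Copp /=; congr pair; ring.
Qed.

Lemma cdot_minus v z z' : cdot v (fun i => z' i - z i)%C = (cdot v z' - cdot v z)%C.
Proof.
  rewrite /cdot /Cminus /Cplus /Copp /=; congr pair; rewrite /dotR;
  elim/big_rec3: _ => [|i a b c _ ->]; ring.
Qed.

Lemma Cmod_cdot_le v z (X : R) : 0 <= X -> (forall i, Cmod (z i) <= X) -> Cmod (cdot v z) <= 2 * l1norm v * X.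
Proof.
  move=> HX Hz; apply: Rle_trans (Cmod_le_Rabs _) _ => /=.
  have H1 := @Rabs_dotR_le v (fun i => fst (z i)) X HX (fun i => Rle_trans _ _ _ (Rabs_fst_le_Cmod _) (Hz i)).
  have H2 := @Rabs_dotR_le v (fun i => snd (z i)) X HX (fun i => Rle_trans _ _ _ (Rabs_snd_le_Cmod _) (Hz i)).
  lra.
Qed.

Definition Cl1 z : R := \big[Rplus/0]_(i < d) Cmod (z i).

Lemma Cmod_le_Cl1 z i : Cmod (z i) <= Cl1 z.
Proof.
  rewrite /Cl1 (bigD1 i) //=.
  rewrite -[X in X <= _]Rplus_0_r; apply: Rplus_le_compat_l.
  by apply: sumR_ge0 => j; exact: Cmod_ge_0.
Qed.

Lemma Cl1_ge0 z : 0 <= Cl1 z.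
Proof. by apply: sumR_ge0 => i; exact: Cmod_ge_0. Qed.

End Vectors.

(** * The perturbation series and its complex derivatives *)

Lemma pow_le_exp (x : R) (m : nat) : 0 <= x -> x ^ m <= exp (x * INR m).
Proof.
  move=> Hx; elim: m => [|m IH]; first by rewrite Rmult_0_r exp_0 /=; lra.
  rewrite S_INR Rmult_plus_distr_l Rmult_1_r Rplus_comm exp_plus /=.
  apply: Rmult_le_compat => //; first exact: pow_le.
  have := exp_ineq1_le x; lra.
Qed.

Lemma le_exp (x : R) : x <= exp x.
Proof. have := exp_ineq1_le x; lra. Qed.

Lemma ctrig_lipschitz (p q : R) (a h : C) : Rabs p <= 1 -> Rabs q <= 1 ->
  Cmod (ctrig p q (a + h) - ctrig p q a)%C <= 8 * Cmod h * exp (Cmod a + 2 * Cmod h).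
Proof.
  move=> Hp Hq.
  have -> : (ctrig p q (a + h) - ctrig p q a =
     (ctrig p q (a + h) - ctrig p q a - h * ctrig q (- p) a) + h * ctrig q (- p) a)%C by ring.
  apply: Rle_trans (Cmod_triangle _ _) _; rewrite Cmod_mult.
  have H1 := ctrig_rem p q a h Hp Hq.
  have H2 : Cmod (ctrig q (- p) a) <= 2 * exp (Cmod a) by apply: Cmod_ctrig_le => //; rewrite Rabs_Ropp.
  have h0 := Cmod_ge_0 h.
  have H3 : Cmod h * exp (Cmod a + Cmod h) <= exp (Cmod a + 2 * Cmod h).
    have -> : Cmod a + 2 * Cmod h = Cmod h + (Cmod a + Cmod h) by ring.
    rewrite [in X in _ <= X]exp_plus; apply: Rmult_le_compat_r; [exact: Rlt_le (exp_pos _)|exact: le_exp].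
  have H4 : exp (Cmod a) <= exp (Cmod a + 2 * Cmod h) by apply: exp_le_mono; lra.
  nra.
Qed.

Lemma Cpow_lipschitz (w h : C) (m : nat) : Cmod h <= 1 ->
  Cmod ((w + h) ^ m - w ^ m)%C <= 2 * Cmod h * (2 * (Cmod w + 1)) ^ m.
Proof.
  move=> Hh; have w0 := Cmod_ge_0 w; have h0 := Cmod_ge_0 h.
  have -> : ((w + h) ^ m - w ^ m = ((w + h) ^ m - w ^ m - h * (INR m * w ^ m.-1))
    + h * (INR m * w ^ m.-1))%C by ring.
  apply: Rle_trans (Cmod_triangle _ _) _; rewrite !Cmod_mult.
  have H1 := Cpow_rem w h m Hh.
  have H2 : Cmod (INR m) * Cmod (w ^ m.-1)%C <= (2 * (Cmod w + 1)) ^ m.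
    rewrite Rpow_mult_distr; apply: Rmult_le_compat; try exact: Cmod_ge_0.
      by rewrite Cmod_R Rabs_pos_eq; [exact: INR_le_pow2 | exact: pos_INR].
    rewrite Cmod_pow; apply: Rle_trans (_ : (Cmod w + 1) ^ m.-1 <= _).
      by apply: pow_incr; lra.
    by apply: Rle_pow; [lra|lia].
  set P := _ ^ m in H1 H2 *.
  have HP : 0 <= P by apply: pow_le; lra.
  have H3 : Cmod h ^ 2 * P <= Cmod h * P by apply: Rmult_le_compat_r => //; nra.
  have H4 := Rmult_le_compat_l _ _ _ h0 H2.
  lra.
Qed.

Section Series.
Context {d : nat} (eps : nat -> R) (K : nat -> 'I_d -> Z).
Notation L n := (l1norm (zvec (K n))).
Notation weight n := (INR n + 1 + L n).
Hypothesis eps_ge0 : forall n, 0 <= eps n.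
(** The only convergence hypothesis. On a bounded set the power of w, the complex phase and the
    frequencies 2 PI K n i are all controlled by exp (A * weight n) with a suitable A, so every
    majorant below has the form of a constant times [eps n * exp (A * weight n)]. *)
Hypothesis eps_summable : forall A, ex_series (fun n => eps n * exp (A * weight n)).

Definition phase (n : nat) (z : 'I_d -> C) : C := (RtoC (2 * PI) * cdot (zvec (K n)) z)%C.

Definition cser (p q : R) (z : 'I_d -> C) (w : C) : C :=
  CSeries (fun n => eps n * w ^ n.+2 * ctrig p q (phase n z))%C.

Lemma weight_ge n : INR n + 1 <= weight n /\ L n <= weight n /\ 0 <= L n /\ 0 <= INR n.
Proof. have H1 := l1norm_ge0 (zvec (K n)); have H2 := pos_INR n; repeat split; lra. Qed.

Lemma ex_series_weight (A c : R) : ex_series (fun n => c * (eps n * exp (A * weight n))).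
Proof. by apply: (ex_series_scal_l (V := R_NormedModule)); exact: eps_summable. Qed.

Lemma phase_le n z (X : R) : 0 <= X -> (forall i, Cmod (z i) <= X) ->
  Cmod (phase n z) <= 4 * PI * X * weight n.
Proof.
  move=> HX Hz; rewrite /phase Cmod_mult Cmod_R Rabs_pos_eq; last by have := PI_RGT_0; lra.
  have := Cmod_cdot_le (zvec (K n)) z X HX Hz.
  have := weight_ge n; have := PI_RGT_0 => HP Hw H.
  have : 2 * L n * X <= 2 * weight n * X by nra.
  nra.
Qed.

Lemma phase_upd n z i (h : C) :
  phase n (upd z i (z i + h)%C) = (phase n z + h * RtoC (2 * PI * IZR (K n i)))%C.
Proof.
  rewrite /phase cdot_upd !RtoC_mult.
  have -> : zvec (K n) i = IZR (K n i) by [].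
  ring.
Qed.

Lemma freq_le n i : Rabs (2 * PI * IZR (K n i)) <= 2 * PI * weight n.
Proof.
  rewrite Rabs_mult Rabs_pos_eq; last by have := PI_RGT_0; lra.
  have := Rabs_le_l1norm (zvec (K n)) i; have := weight_ge n; have := PI_RGT_0.
  move=> *; apply: Rmult_le_compat_l; first lra.
  apply: Rle_trans (_ : L n <= _); [done|lra].
Qed.

Lemma pow_weight_le (x : R) n : 0 <= x -> x ^ n.+2 <= exp (2 * x * weight n).
Proof.
  move=> Hx; apply: Rle_trans (pow_le_exp x n.+2 Hx) _; apply: exp_le_mono.
  rewrite !S_INR; have := weight_ge n => H.
  have : x * (INR n + 1 + 1) <= x * (2 * weight n) by apply: Rmult_le_compat_l; lra.
  lra.
Qed.

Lemma Cmod_eps n : Cmod (eps n) = eps n.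
Proof. by rewrite Cmod_R Rabs_pos_eq. Qed.

Lemma cser_derive_w (p q : R) (z : 'I_d -> C) (w : C) : Rabs p <= 1 -> Rabs q <= 1 ->
  is_derive (K := C_AbsRing) (V := C_NormedModule) (cser p q z) w
    (CSeries (fun n => eps n * (INR n.+2 * w ^ n.+1) * ctrig p q (phase n z))%C).
Proof.
  move=> Hp Hq.
  set c := Cmod w + 1; have w0 := Cmod_ge_0 w.
  (* The summand 4 c pays for (2 c)^(n+2), where the 2 comes from [Cpow_rem], and 4 PI Cl1 z pays
     for the exponential of the phase. *)
  pose A := 4 * c + 4 * PI * Cl1 z.
  have bnd : forall n (x : C), Cmod x <= (2 * c) ^ n.+2 ->
      Cmod (eps n * x * ctrig p q (phase n z))%C <= 2 * (eps n * exp (A * weight n)).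
    move=> n x Hx; rewrite !Cmod_mult Cmod_eps.
    have H1 : (2 * c) ^ n.+2 <= exp (2 * (2 * c) * weight n) by apply: pow_weight_le; rewrite /c; lra.
    have H2 := Cmod_ctrig_le p q (phase n z) Hp Hq.
    have H3 : exp (Cmod (phase n z)) <= exp (4 * PI * Cl1 z * weight n).
      by apply: exp_le_mono; apply: phase_le; [exact: Cl1_ge0 | exact: Cmod_le_Cl1].
    have -> : A * weight n = 2 * (2 * c) * weight n + 4 * PI * Cl1 z * weight n by rewrite /A; ring.
    rewrite exp_plus.
    have -> : forall a b e, 2 * (a * (b * e)) = a * b * (2 * e) by move=> *; ring.
    apply: Rmult_le_compat; try exact: Cmod_ge_0.
    - by apply: Rmult_le_pos => //; exact: Cmod_ge_0.
    - by apply: Rmult_le_compat_l => //; lra.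
    - lra.
  have pw : forall (u : C) m, Cmod u <= c -> Cmod (u ^ m)%C <= c ^ m.
    by move=> u m Hu; rewrite Cmod_pow; apply: pow_incr; split => //; exact: Cmod_ge_0.
  have c1 : forall m, 1 <= c ^ m by move=> m; apply: pow_R1_Rle; rewrite /c; lra.
  have t1 : forall m, 1 <= 2 ^ m by move=> m; apply: pow_R1_Rle; lra.
  apply: is_derive_CSeries; last 3 first.
  1-3: exact: (ex_series_weight A 2).
  - move=> n h Hh; apply: bnd.
    have := pw (w + h)%C n.+2 => H; apply: Rle_trans (H _) _.
      by apply: Rle_trans (Cmod_triangle _ _) _; rewrite /c; lra.
    rewrite Rpow_mult_distr; have := c1 n.+2; have := t1 n.+2; nra.
  - move=> n; apply: bnd; rewrite Cmod_mult Rpow_mult_distr; apply: Rmult_le_compat; try exact: Cmod_ge_0.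
      by rewrite Cmod_R Rabs_pos_eq; [exact: INR_le_pow2 | exact: pos_INR].
    apply: Rle_trans (pw w n.+1 _) _; first by rewrite /c; lra.
    by apply: Rle_pow; [rewrite /c; lra|lia].
  - move=> n h Hh.
    have -> : (eps n * (w + h) ^ n.+2 * ctrig p q (phase n z) - eps n * w ^ n.+2 * ctrig p q (phase n z)
       - h * (eps n * (INR n.+2 * w ^ n.+1) * ctrig p q (phase n z)))%C
      = (eps n * ((w + h) ^ n.+2 - w ^ n.+2 - h * (INR n.+2 * w ^ n.+2.-1)) * ctrig p q (phase n z))%C.
      rewrite [n.+2.-1]/=; ring.
    (* For nonzero h the remainder is divided by |h|^2, so that [bnd] applies to the quotient. *)
    case: (Req_dec (Cmod h) 0) => [/Cmod_eq_0 ->|h0].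
      rewrite Cmod_0 Cplus_0_r.
      have -> : (eps n * (w ^ n.+2 - w ^ n.+2 - 0 * (INR n.+2 * w ^ n.+2.-1)) * ctrig p q (phase n z) = 0)%C by ring.
      by rewrite Cmod_0; lra.
    have hp : 0 < Cmod h by have := Cmod_ge_0 h; lra.
    set r := (_ - _ - _)%C.
    have Hr : Cmod r <= Cmod h ^ 2 * (2 * c) ^ n.+2 by exact: Cpow_rem.
    have hp2 : 0 < Cmod h ^ 2 by exact: pow_lt.
    have E : (r = (RtoC (Cmod h ^ 2)) * (r * RtoC (/ Cmod h ^ 2)))%C.
      transitivity (r * RtoC (Cmod h ^ 2 * / Cmod h ^ 2))%C; last by rewrite RtoC_mult; ring.
      rewrite Rinv_r; [ring | lra].
    have -> : (eps n * r * ctrig p q (phase n z) =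
      RtoC (Cmod h ^ 2) * (eps n * (r * RtoC (/ Cmod h ^ 2)) * ctrig p q (phase n z)))%C.
      rewrite {1}E; ring.
    rewrite Cmod_mult Cmod_R (Rabs_pos_eq (Cmod h ^ 2)); last lra.
    rewrite Rmult_comm; apply: Rmult_le_compat_r; first lra.
    apply: bnd; rewrite Cmod_mult Cmod_R Rabs_pos_eq; last by apply: Rlt_le; exact: Rinv_0_lt_compat.
    apply: (Rmult_le_reg_r (Cmod h ^ 2)) => //.
    rewrite Rmult_assoc Rinv_l; lra.
Qed.

Lemma cser_derive_z (p q : R) (z : 'I_d -> C) (w : C) i : Rabs p <= 1 -> Rabs q <= 1 ->
  is_derive (K := C_AbsRing) (V := C_NormedModule) (fun u => cser p q (upd z i u) w) (z i)
    (CSeries (fun n => eps n * w ^ n.+2 * (RtoC (2 * PI * IZR (K n i)) * ctrig q (- p) (phase n z)))%C).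
Proof.
  move=> Hp Hq; have Hp' : Rabs (- p) <= 1 by rewrite Rabs_Ropp.
  have w0 := Cmod_ge_0 w; have P0 := PI_RGT_0.
  pose A := 2 * Cmod w + 4 * PI * Cl1 z + 6 * PI.
  (* With k the frequency, one |k| covers the shift of the phase by h k with |h| <= 1, and two cover
     the factor k^2 of the quadratic remainder, through |k| <= exp |k|. *)
  pose E n := exp (Cmod (phase n z) + 3 * Rabs (2 * PI * IZR (K n i))).
  have bnd : forall n (x : C) (y : R), 0 <= y -> Cmod x <= 6 * E n * y ->
      Cmod (eps n * w ^ n.+2 * x)%C <= 6 * (eps n * exp (A * weight n)) * y.
    move=> n x y Hy Hx; rewrite !Cmod_mult Cmod_eps Cmod_pow.
    have H1 := pow_weight_le (Cmod w) n w0.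
    have H3 : E n <= exp (4 * PI * Cl1 z * weight n + 6 * PI * weight n).
      apply: exp_le_mono; have := freq_le n i.
      have := phase_le n z (Cl1 z) (Cl1_ge0 z) (Cmod_le_Cl1 z); lra.
    have -> : A * weight n = 2 * Cmod w * weight n + (4 * PI * Cl1 z * weight n + 6 * PI * weight n) by rewrite /A; ring.
    rewrite exp_plus.
    have -> : forall a b e, 6 * (a * (b * e)) * y = a * b * (6 * e * y) by move=> *; ring.
    apply: Rmult_le_compat; try exact: Cmod_ge_0.
    - by apply: Rmult_le_pos => //; exact: (pow_le (Cmod w) n.+2).
    - by apply: Rmult_le_compat_l => //; lra.
    - apply: Rle_trans Hx _; apply: Rmult_le_compat_r => //; lra.
  apply: is_derive_CSeries; last 3 first.
  1-3: exact: (ex_series_weight A 6).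
  - move=> n h Hh; rewrite -[X in _ <= X]Rmult_1_r; apply: bnd; first lra.
    rewrite phase_upd.
    apply: Rle_trans (Cmod_ctrig_le _ _ _ Hp Hq) _.
    set k := 2 * PI * _; set a := phase n z.
    have : exp (Cmod (a + h * RtoC k)%C) <= E n.
      apply: exp_le_mono; apply: Rle_trans (Cmod_triangle _ _) _; rewrite Cmod_mult Cmod_R -/a -/k.
      have := Rabs_pos k; nra.
    have := exp_pos (Cmod (a + h * RtoC k)%C); lra.
  - move=> n; rewrite -[X in _ <= X]Rmult_1_r; apply: bnd; first lra.
    rewrite Cmod_mult Cmod_R.
    set k := 2 * PI * _.
    have H1 := Cmod_ctrig_le q (- p) (phase n z) Hq Hp'.
    have H2 : Rabs k * exp (Cmod (phase n z)) <= E n.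
      rewrite /E -/k Rplus_comm exp_plus; apply: Rmult_le_compat_r; first exact: Rlt_le (exp_pos _).
      have := le_exp (3 * Rabs k); have := Rabs_pos k; lra.
    have := Rabs_pos k; have := Cmod_ge_0 (ctrig q (- p) (phase n z)).
    have := exp_pos (Cmod (phase n z)); nra.
  - move=> n h Hh; rewrite phase_upd.
    have -> : upd z i (z i) = z by apply: functional_extensionality => j; rewrite /upd; case: eqP => [->|].
    set k := 2 * PI * _; set a := phase n z.
    have -> : (eps n * w ^ n.+2 * ctrig p q (a + h * RtoC k) - eps n * w ^ n.+2 * ctrig p q a
        - h * (eps n * w ^ n.+2 * (RtoC k * ctrig q (- p) a)))%C
      = (eps n * w ^ n.+2 * (ctrig p q (a + h * RtoC k) - ctrig p q a - (h * RtoC k) * ctrig q (- p) a))%C by ring.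
    apply: bnd; first exact: pow2_ge_0.
    apply: Rle_trans (ctrig_rem p q a (h * RtoC k) Hp Hq) _.
    rewrite Cmod_mult Cmod_R.
    have h0 := Cmod_ge_0 h; have k0 := Rabs_pos k.
    have H1 : Rabs k * Rabs k * exp (Cmod a + Cmod h * Rabs k) <= E n.
      apply: Rle_trans (_ : exp (Rabs k) * exp (Rabs k) * exp (Cmod a + Rabs k) <= _).
        apply: Rmult_le_compat; try exact: Rlt_le (exp_pos _).
        - nra.
        - by apply: Rmult_le_compat => //; exact: le_exp.
        - apply: exp_le_mono; nra.
      rewrite -!exp_plus; apply: exp_le_mono; rewrite -/a -/k; lra.
    have -> : 6 * (Cmod h * Rabs k) ^ 2 * exp (Cmod a + Cmod h * Rabs k)
      = 6 * (Rabs k * Rabs k * exp (Cmod a + Cmod h * Rabs k)) * Cmod h ^ 2 by ring.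
    by apply: Rmult_le_compat_r; [exact: pow2_ge_0 | lra].
Qed.

(** The increment of a term is split into a change of phase and a change of power; each is at most
    delta times a summable majorant, so the whole sum is small with delta. *)
Lemma cser_continuous (p q : R) (z : 'I_d -> C) (w : C) (e : R) : Rabs p <= 1 -> Rabs q <= 1 -> 0 < e ->
  exists delta, 0 < delta /\ forall z' w', cdist z z' delta -> Cmod (w' - w)%C < delta ->
    Cmod (cser p q z' w' - cser p q z w)%C < e.
Proof.
  move=> Hp Hq He; have w0 := Cmod_ge_0 w; have P0 := PI_RGT_0.
  set c := Cmod w + 1.
  (* As delta <= 1, the phase moves by at most N = 4 PI weight n. The Lipschitz bound costs exp (2
     N) and its factor N another exp N, hence 3 N and the 12 PI. The 12 in [B] is 8 for the phase
     plus 4 for the power. *)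
  pose A := 4 * c + 4 * PI * Cl1 z + 12 * PI.
  pose B n := 12 * (eps n * exp (A * weight n)).
  have HB : ex_series B by exact: ex_series_weight.
  have SB : 0 <= Series B.
    apply: Rle_trans (Rabs_pos _) (Series_dom B B _ HB) => n.
    rewrite Rabs_pos_eq; first lra.
    by rewrite /B; apply: Rmult_le_pos; [lra|apply: Rmult_le_pos => //; exact: Rlt_le (exp_pos _)].
  pose dl := Rmin 1 (e / (2 * Series B + 1)).
  have Hd : 0 < dl by apply: Rmin_pos; [lra | apply: Rdiv_lt_0_compat; lra].
  have Hd1 : dl <= 1 by exact: Rmin_l.
  have Hd2 : dl <= e / (2 * Series B + 1) by exact: Rmin_r.
  exists dl; split => // z' w' Hz Hw.
  set h := (w' - w)%C in Hw.
  have h0 := Cmod_ge_0 h.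
  have c1 : 1 <= c by rewrite /c; lra.
  have key : forall n,
     [/\ Cmod (eps n * w' ^ n.+2 * ctrig p q (phase n z'))%C <= B n,
         Cmod (eps n * w ^ n.+2 * ctrig p q (phase n z))%C <= B n &
         Cmod (eps n * w' ^ n.+2 * ctrig p q (phase n z') - eps n * w ^ n.+2 * ctrig p q (phase n z))%C
           <= dl * B n].
    move=> n.
    set a := phase n z; set eta := (phase n z' - a)%C; set N := 4 * PI * weight n.
    have -> : phase n z' = (a + eta)%C by rewrite /eta; ring.
    have -> : w' = (w + h)%C by rewrite /h; ring.
    have Heta : Cmod eta <= dl * N.
      have -> : eta = phase n (fun i => z' i - z i)%C by rewrite /eta /a /phase cdot_minus; ring.
      have := phase_le n (fun i => z' i - z i)%C dl (Rlt_le _ _ Hd) (fun i => Rlt_le _ _ (Hz i)).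
      by rewrite /N; lra.
    have N0 : 0 <= N by rewrite /N; have := weight_ge n; nra.
    have eta0 := Cmod_ge_0 eta.
    have etaN : Cmod eta <= N by nra.
    have pc : 0 < (2 * c) ^ n.+2 by apply: pow_lt; lra.
    have EX : exp (Cmod a + 3 * N) * (2 * c) ^ n.+2 <= exp (A * weight n).
      have -> : A * weight n = (4 * PI * Cl1 z * weight n + 3 * N) + 2 * (2 * c) * weight n
        by rewrite /A /N; ring.
      rewrite (exp_plus (_ + _)); apply: Rmult_le_compat; try lra.
      - exact: Rlt_le (exp_pos _).
      - apply: exp_le_mono; apply: Rplus_le_compat_r; apply: phase_le; [exact: Cl1_ge0 | exact: Cmod_le_Cl1].
      - by apply: pow_weight_le; lra.
    have a0 := Cmod_ge_0 a.
    have Hpw : forall u : C, Cmod u <= c -> Cmod (u ^ n.+2)%C <= (2 * c) ^ n.+2.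
      by move=> u Hu; rewrite Cmod_pow; apply: pow_incr; split; [exact: Cmod_ge_0 | lra].
    have Hwh : Cmod (w + h)%C <= c by apply: Rle_trans (Cmod_triangle _ _) _; rewrite /c; lra.
    have Hww : Cmod w <= c by rewrite /c; lra.
    have bnd : forall x y : C, Cmod x <= (2 * c) ^ n.+2 -> forall t, 0 <= t ->
       Cmod y <= t * exp (Cmod a + 3 * N) -> Cmod (eps n * x * y)%C <= t * (eps n * exp (A * weight n)).
      move=> x y Hx t Ht Hy; rewrite !Cmod_mult Cmod_eps.
      apply: Rle_trans (_ : eps n * (2 * c) ^ n.+2 * (t * exp (Cmod a + 3 * N)) <= _).
        apply: Rmult_le_compat => //; try exact: Cmod_ge_0.
        - by apply: Rmult_le_pos => //; exact: Cmod_ge_0.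
        - exact: Rmult_le_compat_l.
      have -> : eps n * (2 * c) ^ n.+2 * (t * exp (Cmod a + 3 * N))
         = t * (eps n * (exp (Cmod a + 3 * N) * (2 * c) ^ n.+2)) by ring.
      by apply: Rmult_le_compat_l => //; apply: Rmult_le_compat_l.
    have bT : forall b : C, Cmod b <= N -> Cmod (ctrig p q (a + b)) <= 2 * exp (Cmod a + 3 * N).
      move=> b Hb; apply: Rle_trans (Cmod_ctrig_le _ _ _ Hp Hq) _.
      apply: Rmult_le_compat_l; first lra.
      by apply: exp_le_mono; apply: Rle_trans (Cmod_triangle _ _) _; lra.
    have bT0 : Cmod (ctrig p q a) <= 2 * exp (Cmod a + 3 * N).
      by have := bT 0%C; rewrite Cplus_0_r Cmod_0; apply; lra.
    have ee : 0 <= eps n * exp (A * weight n) by apply: Rmult_le_pos => //; exact: Rlt_le (exp_pos _).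
    split.
    - apply: Rle_trans (bnd _ _ (Hpw _ Hwh) 2 _ (bT _ etaN)) _; rewrite /B; lra.
    - apply: Rle_trans (bnd _ _ (Hpw _ Hww) 2 _ bT0) _; rewrite /B; lra.
    - have -> : (eps n * (w + h) ^ n.+2 * ctrig p q (a + eta) - eps n * w ^ n.+2 * ctrig p q a
         = eps n * w ^ n.+2 * (ctrig p q (a + eta) - ctrig p q a)
           + ((w + h) ^ n.+2 - w ^ n.+2) * (eps n * ctrig p q (a + eta)))%C by ring.
      apply: Rle_trans (Cmod_triangle _ _) _.
      have -> : dl * B n = 8 * dl * (eps n * exp (A * weight n)) + 4 * dl * (eps n * exp (A * weight n))
        by rewrite /B; ring.
      apply: Rplus_le_compat.
      + apply: bnd; [exact: Hpw | lra |].
        apply: Rle_trans (ctrig_lipschitz p q a eta Hp Hq) _.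
        have -> : 8 * dl * exp (Cmod a + 3 * N) = 8 * (dl * exp (Cmod a + 3 * N)) by ring.
        rewrite Rmult_assoc; apply: Rmult_le_compat_l; first lra.
        apply: Rle_trans (_ : dl * N * exp (Cmod a + 2 * N) <= _).
          by apply: Rmult_le_compat => //; [exact: Rlt_le (exp_pos _)|apply: exp_le_mono; lra].
        rewrite Rmult_assoc; apply: Rmult_le_compat_l; first lra.
        have -> : Cmod a + 3 * N = N + (Cmod a + 2 * N) by ring.
        rewrite [in X in _ <= X]exp_plus; apply: Rmult_le_compat_r; [exact: Rlt_le (exp_pos _)|exact: le_exp].
      + have HL := Cpow_lipschitz w h n.+2 (Rle_trans _ _ _ (Rlt_le _ _ Hw) Hd1).
        rewrite !Cmod_mult Cmod_eps.
        have HT := bT _ etaN.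
        apply: Rle_trans (_ : (2 * dl * (2 * c) ^ n.+2) * (eps n * (2 * exp (Cmod a + 3 * N))) <= _).
          apply: Rmult_le_compat; try exact: Cmod_ge_0.
          - by apply: Rmult_le_pos => //; exact: Cmod_ge_0.
          - by apply: Rle_trans HL _; apply: Rmult_le_compat_r; rewrite -/c; lra.
          - exact: Rmult_le_compat_l.
        have -> : 2 * dl * (2 * c) ^ n.+2 * (eps n * (2 * exp (Cmod a + 3 * N)))
          = 4 * dl * (eps n * (exp (Cmod a + 3 * N) * (2 * c) ^ n.+2)) by ring.
        apply: Rmult_le_compat_l; first lra.
        exact: Rmult_le_compat_l.
  rewrite /cser -(CSeries_minus _ _ B B) //; try by move=> n; case: (key n).
  apply: Rle_lt_trans (_ : 2 * Series (fun n => dl * B n) < _).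
    apply: CSeries_dom; first by move=> n; case: (key n).
    exact: (ex_series_scal_l (V := R_NormedModule)).
  rewrite Series_scal_l.
  have : dl * (2 * Series B + 1) <= e.
    apply: Rle_trans (Rmult_le_compat_r _ _ _ _ Hd2) _; first lra.
    by apply: Req_le; field; lra.
  lra.
Qed.

End Series.

(** * The Hamiltonian and its Birkhoff normal form *)

Lemma is_derive_big (I : Type) (r : seq I) (f : I -> R -> R) (x : R) (f' : I -> R) :
  (forall m, is_derive (f m) x (f' m)) ->
  is_derive (fun u => \big[Rplus/0]_(m <- r) f m u) x (\big[Rplus/0]_(m <- r) f' m).
Proof.
  move=> H; elim: r => [|m r IH].
    rewrite big_nil; apply: (is_derive_ext (fun _ => 0)); first by move=> t; rewrite big_nil.
    exact: is_derive_const.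
  rewrite big_cons; apply: (is_derive_ext (fun u => f m u + \big[Rplus/0]_(m <- r) f m u)).
    by move=> t; rewrite big_cons.
  exact: is_derive_plus.
Qed.

Lemma Series_tail (u : nat -> R) (N : nat) : ex_series u ->
  Series u = \big[Rplus/0]_(m < N) u m + Series (fun k => u (N + k)%N).
Proof.
  move=> Hu; elim: N => [|N IH].
    by rewrite big_ord0 Rplus_0_l; apply: Series_ext.
  rewrite big_ord_recr /= IH (Series_incr_1 (fun k => u (N + k)%N)).
    rewrite addn0 Rplus_assoc; congr (_ + (_ + _)); apply: Series_ext => k.
    by rewrite addnS.
  by apply/(ex_series_incr_n u N).
Qed.

Lemma ctrig_continuous (p q : R) (a : C) (e : R) : Rabs p <= 1 -> Rabs q <= 1 -> 0 < e ->
  exists delta, 0 < delta /\ forall h, Cmod h < delta -> Cmod (ctrig p q (a + h) - ctrig p q a)%C < e.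
Proof.
  move=> Hp Hq He; set M := 8 * exp (Cmod a + 2).
  have HM : 0 < M by rewrite /M; have := exp_pos (Cmod a + 2); lra.
  exists (Rmin 1 (e / M)); split.
    by apply: Rmin_pos; [lra|exact: Rdiv_lt_0_compat].
  move=> h Hh.
  have H1 := Rlt_le_trans _ _ _ Hh (Rmin_l _ _).
  have H2 := Rlt_le_trans _ _ _ Hh (Rmin_r _ _).
  apply: Rle_lt_trans (ctrig_lipschitz p q a h Hp Hq) _.
  apply: Rle_lt_trans (_ : M * Cmod h < _).
    have h0 := Cmod_ge_0 h.
    have : exp (Cmod a + 2 * Cmod h) <= exp (Cmod a + 2) by apply: exp_le_mono; lra.
    by rewrite /M; nra.
  have -> : e = M * (e / M) by field; lra.
  exact: Rmult_lt_compat_l.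
Qed.

Section Hamiltonian.
Context {d : nat} (om : 'I_d -> R) (l : 'I_d) (eps : nat -> R) (K : nat -> 'I_d -> Z).
Notation weight n := (INR n + 1 + l1norm (zvec (K n))).
Hypothesis eps_ge0 : forall n, 0 <= eps n.
Hypothesis eps_summable : forall A, ex_series (fun n => eps n * exp (A * weight n)).
Hypothesis K_l : forall n, K n l = 0%Z.

Definition angle (n : nat) (th : 'I_d -> R) : R := 2 * PI * dotR (zvec (K n)) th.

Definition rser (p q : R) (th : 'I_d -> R) (r : R) : R :=
  Series (fun n => eps n * r ^ n.+2 * (p * cos (angle n th) + q * sin (angle n th))).

Definition ham (th r : 'I_d -> R) : R := dotR om r + rser 0 1 th (r l).

Lemma phase_cvec n th : phase K n (cvec th) = RtoC (angle n th).
Proof. by rewrite /phase cdot_cvec /angle -RtoC_mult. Qed.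

Lemma CSeries_R (u : nat -> C) (v : nat -> R) : (forall n, u n = RtoC (v n)) -> CSeries u = RtoC (Series v).
Proof.
  move=> H; rewrite /CSeries /RtoC; congr pair; first by apply: Series_ext => n; rewrite H.
  rewrite (Series_ext _ (fun n => 0 * v n)); first by rewrite Series_scal_l; ring.
  by move=> n; rewrite H /=; ring.
Qed.

Lemma cser_cvec p q th (r : R) : cser eps K p q (cvec th) (RtoC r) = RtoC (rser p q th r).
Proof.
  apply: CSeries_R => n.
  by rewrite phase_cvec ctrig_R -RtoC_pow !RtoC_mult.
Qed.

Lemma cvec_upd (th : 'I_d -> R) i (u : R) : upd (cvec th) i (RtoC u) = cvec (upd th i u).
Proof. by apply: functional_extensionality => j; rewrite /upd /cvec; case: eqP. Qed.

Lemma Rabs01 : Rabs 0 <= 1 /\ Rabs 1 <= 1.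
Proof. rewrite Rabs_R0 Rabs_R1; lra. Qed.

Lemma ham_entire : real_entire ham.
Proof.
  have [H0 H1] := Rabs01.
  exists (fun z W => cdot om W + cser eps K 0 1 z (W l))%C; split; [split; [|split]|split].
  - move=> z W e He.
    have [|dl [Hd Hc]] := cser_continuous eps K eps_ge0 eps_summable 0 1 z (W l) (e / 2) H0 H1; first lra.
    have L0 := l1norm_ge0 om.
    set M := 2 * l1norm om + 1.
    have HM : 0 < M by rewrite /M; lra.
    pose dl' := Rmin dl (e / (2 * M)).
    have Hd' : 0 < dl' by apply: Rmin_pos => //; apply: Rdiv_lt_0_compat; lra.
    have Hd1 : dl' <= dl by exact: Rmin_l.
    have Hd2 : dl' <= e / (2 * M) by exact: Rmin_r.
    exists dl'; split => // z' W' Hz HW.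
    have -> : (cdot om W' + cser eps K 0 1 z' (W' l) - (cdot om W + cser eps K 0 1 z (W l))
      = cdot om (fun i => W' i - W i) + (cser eps K 0 1 z' (W' l) - cser eps K 0 1 z (W l)))%C.
      rewrite cdot_minus; ring.
    apply: Rle_lt_trans (Cmod_triangle _ _) _.
    have A1 := Cmod_cdot_le om (fun i => W' i - W i)%C dl' (Rlt_le _ _ Hd') (fun i => Rlt_le _ _ (HW i)).
    have A2 : Cmod (cser eps K 0 1 z' (W' l) - cser eps K 0 1 z (W l))%C < e / 2.
      apply: Hc; last exact: Rlt_le_trans (HW l) Hd1.
      by move=> i; exact: Rlt_le_trans (Hz i) Hd1.
    have A3 : M * dl' <= e / 2.
      apply: Rle_trans (Rmult_le_compat_l _ _ _ (Rlt_le _ _ HM) Hd2) _.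
      by apply: Req_le; field; lra.
    rewrite /M in A3; lra.
  - move=> z W i.
    have [D HD] : ex_derive (K := C_AbsRing) (V := C_NormedModule)
        (fun u => cser eps K 0 1 (upd z i u) (W l)) (z i).
      by eexists; apply: (cser_derive_z eps K eps_ge0 eps_summable).
    eexists; apply: (is_derive_plus (K := C_AbsRing) (V := C_NormedModule)) HD.
    exact: is_derive_const.
  - move=> z W i.
    have Hlin : is_derive (K := C_AbsRing) (V := C_NormedModule) (fun u => cdot om (upd W i u)) (W i) (RtoC (om i)).
      apply: (@is_derive_C_quadratic _ _ _ 0) => h _.
      rewrite !cdot_upd.
      have -> : (cdot om W + (W i + h - W i) * RtoC (om i) - (cdot om W + (W i - W i) * RtoC (om i))
        - h * RtoC (om i) = 0)%C by ring.
      rewrite Cmod_0; lra.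
    case: (eqVneq i l) => [-> |Hil] in Hlin *.
    + eexists; apply: (is_derive_plus (K := C_AbsRing) (V := C_NormedModule)); first exact: Hlin.
      apply: (is_derive_ext (K := C_AbsRing) (V := C_NormedModule) (cser eps K 0 1 z)).
        by move=> t; rewrite upd_same.
      by apply: (cser_derive_w eps K eps_ge0 eps_summable).
    + eexists; apply: (is_derive_plus (K := C_AbsRing) (V := C_NormedModule)); first exact: Hlin.
      apply: (is_derive_ext (K := C_AbsRing) (V := C_NormedModule) (fun _ => cser eps K 0 1 z (W l))).
        by move=> t; rewrite upd_other // eq_sym.
      exact: is_derive_const.
  - move=> z W i; congr Cplus; apply: CSeries_ext => n.
    by rewrite phase_upd Cmult_1_l ctrig_periodic.
  - move=> th r; rewrite cdot_cvec -[cvec r l]/(RtoC (r l)) cser_cvec -RtoC_plus //.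
Qed.

Lemma ham_derive_th i th r :
  dth ham i th r =
    Series (fun n => eps n * r l ^ n.+2 * (2 * PI * IZR (K n i)) * cos (angle n th)).
Proof.
  have [H0 H1] := Rabs01.
  apply: is_derive_unique.
  have HD := cser_derive_z eps K eps_ge0 eps_summable 0 1 (cvec th) (RtoC (r l)) i H0 H1.
  have := is_derive_R_of_C _ (fun u => rser 0 1 (upd th i u) (r l)) (th i) _ HD.
  rewrite (CSeries_R _ (fun n => eps n * r l ^ n.+2 * (2 * PI * IZR (K n i)) * cos (angle n th))); last first.
    move=> n; rewrite phase_cvec ctrig_R -RtoC_pow -!RtoC_mult; congr RtoC; ring.
  move=> /= H; rewrite -[X in is_derive _ _ X]Rplus_0_l.
  apply: (is_derive_plus (V := R_NormedModule)); first exact: is_derive_const.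
  by apply: H => u; rewrite cvec_upd cser_cvec.
Qed.

Lemma ham_derive_r i th r :
  dr ham i th r = om i + if i == l then
    Series (fun n => eps n * (INR n.+2 * r l ^ n.+1) * sin (angle n th)) else 0.
Proof.
  have [H0 H1] := Rabs01.
  apply: is_derive_unique; apply: (is_derive_plus (V := R_NormedModule)).
    apply: (is_derive_ext (fun u => dotR om r + om i * (u - r i))); first by move=> t; rewrite dotR_upd.
    by auto_derive => //; ring.
  case: (eqVneq i l) => [->|Hil].
    apply: (is_derive_ext (rser 0 1 th)); first by move=> t; rewrite upd_same.
    have HD := cser_derive_w eps K eps_ge0 eps_summable 0 1 (cvec th) (RtoC (r l)) H0 H1.
    have := is_derive_R_of_C _ (rser 0 1 th) (r l) _ HD.
    rewrite (CSeries_R _ (fun n => eps n * (INR n.+2 * r l ^ n.+1) * sin (angle n th))); last first.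
      move=> n; rewrite phase_cvec ctrig_R -RtoC_pow -!RtoC_mult; congr RtoC; ring.
    by apply => u; rewrite cser_cvec.
  apply: (is_derive_ext (fun _ => rser 0 1 th (r l))); first by move=> t; rewrite upd_other // eq_sym.
  exact: is_derive_const.
Qed.

Lemma eps_ex_series : ex_series eps.
Proof.
  apply: ex_series_ext (eps_summable 0) => n.
  by rewrite Rmult_0_l exp_0 Rmult_1_r.
Qed.

(** The constant is the sum of the remaining amplitudes, as |r| <= 1 and |sin| <= 1. The bound is in
    terms of some s >= |r| so that s can be the norm of the whole action vector. N = 0 yields the
    O(r^2) claim, larger N the normal form. *)
Lemma rser_tail th (N : nat) : exists c, forall r s, Rabs r <= s -> s <= 1 ->
  Rabs (rser 0 1 th r - \big[Rplus/0]_(m < N) (eps m * r ^ m.+2 * sin (angle m th))) <= c * s ^ N.+2.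
Proof.
  have Ee := eps_ex_series.
  have EN : ex_series (fun k => eps (N + k)%N) by apply/(ex_series_incr_n eps N).
  exists (Series (fun k => eps (N + k)%N)) => r s Hr Hs.
  have r0 := Rabs_pos r.
  set u := fun n => eps n * r ^ n.+2 * sin (angle n th).
  have Hs1 : forall x, Rabs (sin x) <= 1 by move=> x; apply: Rabs_le; have := SIN_bound x; lra.
  have Hu : forall n, Rabs (u n) <= eps n * Rabs r ^ n.+2.
    move=> n; rewrite /u RPow_abs.
    move: (Hs1 (angle n th)) (eps_ge0 n); move: (r ^ n.+2) (sin _) (eps n) => a b e Hb He.
    rewrite !Rabs_mult (Rabs_pos_eq e He) -[X in _ <= X]Rmult_1_r.
    apply: Rmult_le_compat_l => //; apply: Rmult_le_pos => //; exact: Rabs_pos.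
  have rp : forall m, Rabs r ^ m <= 1.
    by move=> m; rewrite -(pow1 m); apply: pow_incr; lra.
  have -> : rser 0 1 th r = Series u by apply: Series_ext => n; rewrite /u; ring.
  have Hue : ex_series u.
    apply: (ex_series_dom _ eps) => // n; apply: Rle_trans (Hu n) _.
    have := rp n.+2; have := eps_ge0 n; nra.
  rewrite (Series_tail u N) // Rplus_comm /Rminus Rplus_assoc Rplus_opp_r Rplus_0_r.
  rewrite -Series_scal_r; apply: Series_dom; last exact: ex_series_scal_r.
  move=> k; apply: Rle_trans (Hu _) _; apply: Rmult_le_compat_l => //.
  have -> : (N + k).+2 = (N.+2 + k)%coq_nat by rewrite plusE.
  rewrite pow_add.
  have A1 : Rabs r ^ N.+2 <= s ^ N.+2 by apply: pow_incr.
  have A2 : 0 <= Rabs r ^ N.+2 by exact: pow_le.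
  have := rp k; have := pow_le (Rabs r) k r0; nra.
Qed.

Lemma ham_bigO th : bigO_at0 (fun r => ham th r - dotR om r) 2.
Proof.
  have [c Hc] := rser_tail th 0.
  exists c, 1; split; first lra.
  move=> r Hr; rewrite /ham.
  have := Hc (r l) (supnorm r) (Rabs_le_supnorm r l) (Rlt_le _ _ Hr).
  rewrite big_ord0.
  by have -> : dotR om r + rser 0 1 th (r l) - dotR om r = rser 0 1 th (r l) - 0 by ring.
Qed.

(** * Formal conjugation to the linear Hamiltonian *)

Section NormalForm.
Hypothesis om_K : forall n, dotR om (zvec (K n)) <> 0.

Definition gen_coef (n : nat) : R := eps n / (2 * PI * dotR om (zvec (K n))).

(* The homological equation is solved one power of [r l] at a time: the
   coefficient of [r l ^ (n + 2)] is a single trigonometric monomial. *)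
Definition gen_fun (j : 'I_d -> nat) (th : 'I_d -> R) : R :=
  if [forall i, (i == l) || (j i == 0%N)] && (2 <= j l)%N
  then gen_coef (j l - 2) * cos (angle (j l - 2) th) else 0.

Lemma gen_fun_analytic j : real_analytic_torus (gen_fun j).
Proof.
  have [H0 H1] := Rabs01.
  set n := (j l - 2)%N.
  (* With c = 0 for the multi-indices that do not occur, one trigonometric monomial serves all j;
     the truncated difference [j l - 2] is then harmless when [j l] is below 2. *)
  pose c := if [forall i, (i == l) || (j i == 0%N)] && (2 <= j l)%N then gen_coef n else 0.
  have Ej : forall th, gen_fun j th = c * cos (angle n th).
    by move=> th; rewrite /gen_fun /c; case: ifP => _ //; ring.
  exists 1; split; first lra.
  exists (fun z => RtoC c * ctrig 1 0 (phase K n z))%C; split; [split|split].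
  - move=> z _ e He.
    have c0 := Rabs_pos c.
    have [|dl [Hd Hc]] := ctrig_continuous 1 0 (phase K n z) (e / (Rabs c + 1)) H1 H0.
      by apply: Rdiv_lt_0_compat; lra.
    set M := 4 * PI * weight n.
    have HM : 0 < M.
      have := PI_RGT_0; have := weight_ge K n => W P; apply: Rmult_lt_0_compat; lra.
    exists (dl / (2 * M)); split; first by apply: Rdiv_lt_0_compat; lra.
    move=> y Hy.
    have E : (phase K n y = phase K n z + phase K n (fun i => y i - z i))%C.
      by rewrite /phase cdot_minus; ring.
    have Hh : Cmod (phase K n (fun i => y i - z i)%C) < dl.
      apply: Rle_lt_trans (phase_le K n (fun i => y i - z i)%C (dl / (2 * M)) _ (fun i => Rlt_le _ _ (Hy i))) _.
        by apply: Rlt_le; apply: Rdiv_lt_0_compat; lra.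
      have -> : 4 * PI * (dl / (2 * M)) * weight n = M * (dl / (2 * M)) by rewrite /M; ring.
      have -> : M * (dl / (2 * M)) = dl / 2 by field; lra.
      lra.
    have := Hc _ Hh; rewrite -E => H.
    have -> : (RtoC c * ctrig 1 0 (phase K n y) - RtoC c * ctrig 1 0 (phase K n z)
      = RtoC c * (ctrig 1 0 (phase K n y) - ctrig 1 0 (phase K n z)))%C by ring.
    rewrite Cmod_mult Cmod_R.
    have := Cmod_ge_0 (ctrig 1 0 (phase K n y) - ctrig 1 0 (phase K n z))%C.
    have E2 : e = (Rabs c + 1) * (e / (Rabs c + 1)) by field; lra.
    set t := Cmod _ in H *; move=> t0.
    have c1 : 0 < Rabs c + 1 by lra.
    have := Rmult_lt_compat_l _ _ _ c1 H; rewrite -E2; lra.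
  - move=> z i _; set k := 2 * PI * IZR (K n i); set a := phase K n z.
    exists (RtoC c * (RtoC k * ctrig 0 (- (1)) a))%C.
    apply: (@is_derive_C_quadratic _ _ _ (Rabs c * (6 * k ^ 2 * exp (Cmod a + Rabs k)))) => h Hh.
    have -> : upd z i (z i) = z by apply: functional_extensionality => i'; rewrite /upd; case: eqP => [->|].
    rewrite phase_upd -/k -/a.
    have -> : (RtoC c * ctrig 1 0 (a + h * RtoC k) - RtoC c * ctrig 1 0 a
        - h * (RtoC c * (RtoC k * ctrig 0 (- (1)) a)))%C
      = (RtoC c * (ctrig 1 0 (a + h * RtoC k) - ctrig 1 0 a - h * RtoC k * ctrig 0 (- (1)) a))%C by ring.
    rewrite Cmod_mult Cmod_R Rmult_assoc; apply: Rmult_le_compat_l; first exact: Rabs_pos.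
    apply: Rle_trans (ctrig_rem 1 0 a (h * RtoC k) H1 H0) _.
    rewrite Cmod_mult Cmod_R Rpow_mult_distr pow2_abs.
    have h0 := Cmod_ge_0 h; have k0 := Rabs_pos k.
    have : exp (Cmod a + Cmod h * Rabs k) <= exp (Cmod a + Rabs k) by apply: exp_le_mono; nra.
    have : 0 <= Cmod h ^ 2 * k ^ 2 by apply: Rmult_le_pos; exact: pow2_ge_0.
    nra.
  - by move=> z i; rewrite phase_upd Cmult_1_l ctrig_periodic.
  - move=> th; rewrite phase_cvec ctrig_R -RtoC_mult Ej; congr RtoC; ring.
Qed.

Lemma monom_l (r : 'I_d -> R) (j : 'I_d -> nat) :
  (forall i, i != l -> j i = 0%N) -> monom r j = r l ^ j l.
Proof.
  move=> Hj; rewrite /monom (bigD1 l) //= big1; first by rewrite Rmult_1_r.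
  by move=> i /Hj ->.
Qed.

Lemma mdeg_l (j : 'I_d -> nat) : (forall i, i != l -> j i = 0%N) -> mdeg j = j l.
Proof. by move=> Hj; rewrite /mdeg (bigD1 l) //= big1 ?addn0 // => i /Hj ->. Qed.

(** Among the multi-indices of degree at most n only the multiples m of the l-th unit vector
    ([single m]) with 2 <= m <= n contribute. This gives n - 1 terms, and the truncated predecessor
    is also right for n = 0, where the sum is empty. *)
Lemma trunc_gen_fun (n : nat) th r :
  trunc_series gen_fun n th r =
    \big[Rplus/0]_(m < n.-1) (gen_coef m * cos (angle m th) * r l ^ m.+2).
Proof.
  rewrite /trunc_series /trunc_sum.
  pose single (m : 'I_n.+1) : {ffun 'I_d -> 'I_n.+1} := [ffun i => if i == l then m else ord0].
  pose Q (j : {ffun 'I_d -> 'I_n.+1}) := [forall i, (i == l) || (nat_of_ord (j i) == 0%N)].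
  have single0 : forall m i, i != l -> nat_of_ord (single m i) = 0%N.
    by move=> m i /negbTE Hi; rewrite ffunE Hi.
  have singlel : forall m, single m l = m by move=> m; rewrite ffunE eqxx.
  rewrite (bigID Q) /= [X in _ + X]big1 ?Rplus_0_r; last first.
    move=> j /andP [_ HQ]; rewrite /gen_fun.
    case: ifP => [/andP [HQ' _]|_]; last by rewrite Rmult_0_l.
    by move: HQ; rewrite /Q HQ'.
  rewrite (reindex_onto single (fun j => j l)); last first.
    move=> j /andP [_ /forallP HQ]; apply/ffunP => i; rewrite ffunE.
    case: (eqVneq i l) => [->//|Hi]; apply: val_inj => /=.
    by have := HQ i; rewrite (negbTE Hi) /= => /eqP ->.
  rewrite (eq_big xpredT (fun m : 'I_n.+1 => if (2 <= m)%N then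
     gen_coef (m - 2) * cos (angle (m - 2) th) * r l ^ m else 0)); first last.
  - move=> m _; rewrite monom_l ?singlel; last exact: single0.
    rewrite /gen_fun singlel.
    have -> : [forall i, (i == l) || (nat_of_ord (single m i) == 0%N)].
      by apply/forallP => i; case: eqVneq => //= Hi; rewrite single0.
    by rewrite /=; case: ifP => // _; ring.
  - move=> m; rewrite singlel eqxx andbT mdeg_l ?singlel; last exact: single0.
    rewrite -ltnS ltn_ord /=; apply/forallP => i.
    by case: eqVneq => //= Hi; rewrite single0.
  case: n single Q single0 singlel => [|n] _ _ _ _.
    by rewrite big_ord_recl !big_ord0 /= Rplus_0_r.
  rewrite !big_ord_recl /= !Rplus_0_l; apply: eq_bigr => m _.
  by rewrite /bump /= !add1n /= subn2.
Qed.

Lemma dth_trunc_gen_fun (n : nat) th r i :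
  dth (trunc_series gen_fun n) i th r =
    \big[Rplus/0]_(m < n.-1) (- (gen_coef m * (2 * PI) * sin (angle m th) * r l ^ m.+2) * zvec (K m) i).
Proof.
  apply: is_derive_unique.
  apply: (is_derive_ext (fun u => \big[Rplus/0]_(m < n.-1)
     (gen_coef m * cos (angle m th + 2 * PI * (zvec (K m) i * (u - th i))) * r l ^ m.+2))).
    move=> t; rewrite trunc_gen_fun; apply: eq_bigr => m _.
    rewrite /angle dotR_upd; congr (_ * cos _ * _); ring.
  apply: is_derive_big => m.
  auto_derive => //.
  rewrite Rplus_opp_r !Rmult_0_r Rplus_0_r /=; ring.
Qed.

(** Because K n l = 0, the shift g = d_th f has g l = 0, so the perturbation is evaluated at the
    unchanged r l. The linear part contributes dotR om g, which is exactly minus the first n - 1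
    terms of the perturbation; what remains is the tail estimated by [rser_tail]. *)
Lemma ham_BNF : is_BNF ham (fun r => dotR om r).
Proof.
  exists gen_fun; split; [|split].
  - move=> j Hj th; rewrite /gen_fun; case: ifP => // /andP [/forallP HQ Hl].
    move: Hj; rewrite mdeg_l; first by rewrite ltnNge Hl.
    by move=> i Hi; have := HQ i; rewrite (negbTE Hi) /= => /eqP.
  - exact: gen_fun_analytic.
  - move=> n th.
    have [c Hc] := rser_tail th n.-1.
    exists (Rabs c), 1; split; first lra.
    move=> r Hr.
    set g := fun i => dth (trunc_series gen_fun n) i th r.
    have gl : g l = 0.
      rewrite /g dth_trunc_gen_fun big1 // => m _; rewrite /zvec K_l; ring.
    have Hg : dotR om g = - \big[Rplus/0]_(m < n.-1) (eps m * r l ^ m.+2 * sin (angle m th)).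
      have -> : dotR om g = dotR om (fun i => \big[Rplus/0]_(m < n.-1)
          (- (gen_coef m * (2 * PI) * sin (angle m th) * r l ^ m.+2) * zvec (K m) i)).
        by apply: eq_bigr => i _; rewrite /g dth_trunc_gen_fun.
      elim: n.-1 => [|N IH].
        rewrite !big_ord0 Ropp_0 /dotR big1 // => i _; rewrite big_ord0; ring.
      rewrite big_ord_recr /= Ropp_plus_distr -IH.
      have -> : - (eps N * r l ^ N.+2 * sin (angle N th)) =
          - (gen_coef N * (2 * PI) * sin (angle N th) * r l ^ N.+2) * dotR om (zvec (K N)).
        rewrite /gen_coef; field; split; first exact: om_K.
        by have := PI_RGT_0; lra.
      rewrite -dotR_scal -dotR_plus; apply: eq_bigr => i _.
      by rewrite big_ord_recr.
    have Hl : vadd r g l = r l by rewrite /vadd gl Rplus_0_r.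
    rewrite /ham Hl.
    have -> : dotR om (vadd r g) = dotR om r + dotR om g by rewrite -dotR_plus.
    rewrite Hg.
    have := Hc (r l) (supnorm r) (Rabs_le_supnorm r l) (Rlt_le _ _ Hr).
    set S := \big[_/_]_(_ < _) _; set X := rser _ _ _ _.
    have -> : dotR om r + - S + X - dotR om r = X - S by ring.
    move=> H; apply: Rle_trans H _.
    have s0 : 0 <= supnorm r by apply: Rle_trans (Rabs_pos _) (Rabs_le_supnorm r l).
    (* The two exponents agree except at n = 0, where they are 2 and 1 and the bound supnorm r < 1
       is used. *)
    have A1 : supnorm r ^ n.-1.+2 <= supnorm r ^ n.+1.
      case: (n) => [|k] /=; last lra.
      by have := s0; nra.
    have A2 : 0 <= supnorm r ^ n.-1.+2 by exact: pow_le.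
    have := Rle_abs c; have := Rabs_pos c; nra.
Qed.

End NormalForm.
End Hamiltonian.

(** * The Hamiltonian flow *)

(** The sum is even Lipschitz in time with constant [Series b], because f is 1-Lipschitz and the
    products of amplitude and speed are dominated by b. *)
Lemma Series_trig_continuous (f : R -> R) (c al nu b : nat -> R) (t : R) :
  (forall x, Rabs (f x) <= 1) -> (forall x y, Rabs (f x - f y) <= Rabs (x - y)) ->
  (forall n, Rabs (c n) <= b n) -> (forall n, Rabs (c n) * Rabs (nu n) <= b n) -> ex_series b ->
  continuous (fun s => Series (fun n => c n * f (al n + s * nu n))) t.
Proof.
  move=> Hf1 Hf2 Hc Hcn Hb.
  have He : forall s, ex_series (fun n => c n * f (al n + s * nu n)).
    move=> s; apply: ex_series_dom Hb => n; rewrite Rabs_mult.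
    apply: Rle_trans (Hc n); rewrite -[X in _ <= X]Rmult_1_r.
    by apply: Rmult_le_compat_l => //; exact: Rabs_pos.
  have HL : forall s, Rabs (Series (fun n => c n * f (al n + s * nu n)) - Series (fun n => c n * f (al n + t * nu n)))
      <= Series b * Rabs (s - t).
    move=> s; rewrite -Series_minus // -Series_scal_r; apply: Series_dom; last exact: ex_series_scal_r.
    move=> n; rewrite -Rmult_minus_distr_l Rabs_mult.
    apply: Rle_trans (Rmult_le_compat_l _ _ _ (Rabs_pos _) (Hf2 _ _)) _.
    have -> : al n + s * nu n - (al n + t * nu n) = nu n * (s - t) by ring.
    rewrite Rabs_mult -Rmult_assoc; apply: Rmult_le_compat_r => //; exact: Rabs_pos.
  (* The sign is read off from the Lipschitz estimate at two points at distance 1. *)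
  have SB : 0 <= Series b.
    have H := Rle_trans _ _ _ (Rabs_pos _) (HL (t + 1)).
    have E : t + 1 - t = 1 by ring.
    by rewrite E Rabs_R1 in H; lra.
  apply/filterlim_locally => e.
  have Hd : 0 < e / (Series b + 1) by apply: Rdiv_lt_0_compat; [exact: cond_pos | lra].
  exists (mkposreal _ Hd) => s /= Hs.
  have {}Hs : Rabs (s - t) < e / (Series b + 1) by exact: Hs.
  apply: Rle_lt_trans (HL s) _.
  have E : pos e = (Series b + 1) * (e / (Series b + 1)) by field; lra.
  rewrite E; have := Rabs_pos (s - t); nra.
Qed.

Lemma Rabs_sin_sub_le (x y : R) : Rabs (sin x - sin y) <= Rabs (x - y).
Proof.
  case: (MVT_gen sin y x cos) => [u _|u _|c [_ ->]].
  - exact: is_derive_sin.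
  - exact: continuity_sin.
  - rewrite Rabs_mult; have : Rabs (cos c) <= 1 by apply: Rabs_le; have := COS_bound c; lra.
    have := Rabs_pos (x - y); nra.
Qed.

Lemma Rabs_cos_sub_le (x y : R) : Rabs (cos x - cos y) <= Rabs (x - y).
Proof.
  rewrite !cos_sin; have -> : x - y = (PI / 2 + x) - (PI / 2 + y) by ring.
  exact: Rabs_sin_sub_le.
Qed.

Lemma Rabs_sin_le1 (x : R) : Rabs (sin x) <= 1.
Proof. by apply: Rabs_le; have := SIN_bound x; lra. Qed.

Lemma Rabs_cos_le1 (x : R) : Rabs (cos x) <= 1.
Proof. by apply: Rabs_le; have := COS_bound x; lra. Qed.

(** A mean value inequality starting at time 0, where a solution is only known to be
    right-continuous: the mean value theorem is applied on [s, t] with s > 0 so small that f s is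
    within e of f 0. With M = 0 it yields first integrals. *)
Lemma increment_bound_right (f f' : R -> R) (M : R) :
  (forall t, 0 < t -> is_derive f t (f' t)) ->
  filterlim f (at_right 0) (locally (f 0)) ->
  (forall t, 0 < t -> Rabs (f' t) <= M) ->
  forall t, 0 < t -> Rabs (f t - f 0) <= M * t.
Proof.
  move=> Hd Hc HM t Ht.
  apply: le_epsilon => e He.
  case: (proj1 (filterlim_locally _ _) Hc (mkposreal _ He)) => dl Hdl.
  set s := Rmin (dl / 2) (t / 2).
  have dp := cond_pos dl.
  have s0 : 0 < s by apply: Rmin_pos; lra.
  have s1 : s <= dl / 2 by exact: Rmin_l.
  have s2 : s <= t / 2 by exact: Rmin_r.
  have Hs : Rabs (f s - f 0) < e.
    apply: (Hdl s) => //.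
    have H : Rabs (s - 0) < dl by rewrite Rminus_0_r Rabs_pos_eq; lra.
    exact: H.
  have M0 : 0 <= M by exact: Rle_trans (Rabs_pos _) (HM t Ht).
  have Hts : Rabs (f t - f s) <= M * t.
    have E1 : Rmin s t = s by apply: Rmin_left; lra.
    have E2 : Rmax s t = t by apply: Rmax_right; lra.
    case: (MVT_gen f s t f') => [x|x|x [Hx ->]]; rewrite ?E1 ?E2 => *.
    - by apply: Hd; lra.
    - apply/continuity_pt_filterlim; apply: ex_derive_continuous; exists (f' x); apply: Hd; lra.
    - rewrite E1 E2 in Hx; rewrite Rabs_mult (Rabs_pos_eq (t - s)); last lra.
      have := HM x; have := Rabs_pos (f' x); nra.
  have -> : f t - f 0 = (f t - f s) + (f s - f 0) by ring.
  by apply: Rle_trans (Rabs_triang _ _) _; lra.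
Qed.

Section Flow.
Context {d : nat} (om : 'I_d -> R) (l : 'I_d) (eps : nat -> R) (K : nat -> 'I_d -> Z).
Notation weight n := (INR n + 1 + l1norm (zvec (K n))).
Notation ham := (ham om l eps K).
Notation angle := (angle K).
Hypothesis eps_ge0 : forall n, 0 <= eps n.
Hypothesis eps_summable : forall A, ex_series (fun n => eps n * exp (A * weight n)).
Hypothesis K_l : forall n, K n l = 0%Z.

Definition speed (n : nat) : R := 2 * PI * dotR om (zvec (K n)).

Lemma angle_flow n (th Th : 'I_d -> R) (t : R) :
  (forall i, i != l -> Th i = th i + om i * t) -> angle n Th = angle n th + t * speed n.
Proof.
  move=> H; rewrite /angle /speed.
  have -> : dotR (zvec (K n)) Th = dotR (zvec (K n)) (fun i => th i + t * om i).
    apply: eq_bigr => i _; case: (eqVneq i l) => [->|Hi]; first by rewrite /zvec K_l; ring.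
    by rewrite H //; ring.
  rewrite dotR_plus dotR_scal (dotR_sym om); ring.
Qed.

(** Along a solution r l keeps its value a and every [angle n] is affine in time, so the right-hand
    sides of Hamilton's equations are known functions of time. Apart from the constant om, they are
    [kick_th] for th l and, up to sign, [kick_r] for r i. *)
Definition kick_th (th : 'I_d -> R) (a : R) (s : R) : R :=
  Series (fun n => eps n * (INR n.+2 * a ^ n.+1) * sin (angle n th + s * speed n)).

Definition kick_coef (a : R) (i : 'I_d) (n : nat) : R := eps n * a ^ n.+2 * (2 * PI * IZR (K n i)).

Definition kick_r (th : 'I_d -> R) (a : R) (i : 'I_d) (s : R) : R :=
  Series (fun n => kick_coef a i n * cos (angle n th + s * speed n)).

Lemma Rabs_pow_le_exp (a : R) n : Rabs (a ^ n.+2) <= exp (2 * Rabs a * weight n).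
Proof. rewrite -RPow_abs; apply: pow_weight_le; exact: Rabs_pos. Qed.

Lemma kick_coef_le a i n :
  Rabs (kick_coef a i n) <= 2 * PI * (eps n * exp ((2 * Rabs a + 1) * weight n)).
Proof.
  rewrite /kick_coef; have H1 := Rabs_pow_le_exp a n; have H2 := freq_le K n i.
  move: (a ^ _) (2 * PI * IZR _) H1 H2 => b k H1 H2.
  rewrite !Rabs_mult (Rabs_pos_eq (eps n)) //.
  have H3 := le_exp (weight n); have P := PI_RGT_0; have W := weight_ge K n.
  have -> : (2 * Rabs a + 1) * weight n = 2 * Rabs a * weight n + weight n by ring.
  rewrite exp_plus.
  have -> : forall x y z, 2 * PI * (x * (y * z)) = x * y * (2 * PI * z) by move=> *; ring.
  apply: Rmult_le_compat; try exact: Rabs_pos.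
  - by apply: Rmult_le_pos => //; exact: Rabs_pos.
  - exact: Rmult_le_compat_l.
  - by apply: Rle_trans H2 _; apply: Rmult_le_compat_l; lra.
Qed.

Lemma speed_le n : Rabs (speed n) <= 2 * PI * l1norm om * exp (weight n).
Proof.
  have P := PI_RGT_0; have W := weight_ge K n; have L0 := l1norm_ge0 om.
  rewrite /speed Rabs_mult Rabs_pos_eq; last lra.
  rewrite (Rmult_assoc (2 * PI) (l1norm om)); apply: Rmult_le_compat_l; first lra.
  rewrite dotR_sym.
  apply: Rle_trans (Rabs_dotR_le _ _ _ L0 (Rabs_le_l1norm om)) _.
  rewrite Rmult_comm; apply: Rmult_le_compat_l => //.
  have := le_exp (weight n); lra.
Qed.

(** Raising A to A + 1 absorbs the growth of v, which is at most a multiple of exp (weight n), while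
    exp (weight n) >= 1 keeps the same majorant valid for u alone. *)
Lemma ex_series_scaled (u v : nat -> R) (c A : R) : 0 <= c ->
  (forall n, Rabs (u n) <= c * (eps n * exp (A * weight n))) ->
  (forall n, Rabs (v n) <= 2 * PI * l1norm om * exp (weight n)) ->
  exists b, [/\ forall n, Rabs (u n) <= b n, forall n, Rabs (u n) * Rabs (v n) <= b n & ex_series b].
Proof.
  move=> Hc Hu Hv; have P := PI_RGT_0; have L0 := l1norm_ge0 om.
  set D := 2 * PI * l1norm om in Hv.
  have D0 : 0 <= D by rewrite /D; apply: Rmult_le_pos; lra.
  exists (fun n => c * (1 + D) * (eps n * exp ((A + 1) * weight n))); split; last exact: ex_series_weight.
  - move=> n; apply: Rle_trans (Hu n) _; have W := weight_ge K n.
    have -> : (A + 1) * weight n = A * weight n + weight n by ring.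
    rewrite exp_plus; have := one_le_exp (weight n).
    have E0 : 0 <= c * (eps n * exp (A * weight n)).
      by apply: Rmult_le_pos => //; apply: Rmult_le_pos => //; exact: Rlt_le (exp_pos _).
    move=> H; have {}H : 1 <= exp (weight n) by apply: H; lra.
    have -> : c * (1 + D) * (eps n * (exp (A * weight n) * exp (weight n))) =
       (c * (eps n * exp (A * weight n))) * ((1 + D) * exp (weight n)) by ring.
    rewrite -[X in X <= _]Rmult_1_r; apply: Rmult_le_compat_l => //; nra.
  - move=> n; have W := weight_ge K n.
    have -> : (A + 1) * weight n = A * weight n + weight n by ring.
    rewrite exp_plus.
    have E0 : 0 <= c * (eps n * exp (A * weight n)).
      by apply: Rmult_le_pos => //; apply: Rmult_le_pos => //; exact: Rlt_le (exp_pos _).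
    have -> : c * (1 + D) * (eps n * (exp (A * weight n) * exp (weight n))) =
       (c * (eps n * exp (A * weight n))) * ((1 + D) * exp (weight n)) by ring.
    apply: Rmult_le_compat => //; try exact: Rabs_pos.
    apply: Rle_trans (Hv n) _; have := exp_pos (weight n); nra.
Qed.

Lemma kick_r_continuous th a i s : continuous (kick_r th a i) s.
Proof.
  have P := PI_RGT_0.
  have [|b [H1 H2 Hb]] := ex_series_scaled (kick_coef a i) speed (2 * PI) _ _ (kick_coef_le a i) speed_le.
    lra.
  exact: Series_trig_continuous Rabs_cos_le1 Rabs_cos_sub_le H1 H2 Hb.
Qed.

Lemma kick_th_continuous th a s : continuous (kick_th th a) s.
Proof.
  set c := Rabs a + 1; have a0 := Rabs_pos a.
  have Hu : forall n, Rabs (eps n * (INR n.+2 * a ^ n.+1)) <= 1 * (eps n * exp (4 * c * weight n)).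
    move=> n; rewrite Rmult_1_l Rabs_mult Rabs_pos_eq //; apply: Rmult_le_compat_l => //.
    have -> : 4 * c * weight n = 2 * (2 * c) * weight n by ring.
    apply: Rle_trans (pow_weight_le K (2 * c) n _); last by rewrite /c; lra.
    rewrite Rabs_mult Rabs_pos_eq; last exact: pos_INR.
    rewrite Rpow_mult_distr -RPow_abs; apply: Rmult_le_compat; [exact: pos_INR| exact: pow_le|exact: INR_le_pow2|].
    apply: Rle_trans (_ : c ^ n.+1 <= _); first by apply: pow_incr; rewrite /c; lra.
    by apply: Rle_pow; [rewrite /c; lra|lia].
  have [|b [H1 H2 Hb]] := ex_series_scaled _ speed 1 _ _ Hu speed_le; first lra.
  exact: Series_trig_continuous Rabs_sin_le1 Rabs_sin_sub_le H1 H2 Hb.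
Qed.

Lemma is_derive_RInt_continuous (g : R -> R) (t : R) :
  (forall s, continuous g s) -> is_derive (fun s => RInt g 0 s) t (g t).
Proof.
  move=> Hg; apply: is_derive_RInt (Hg t).
  exists (mkposreal 1 Rlt_0_1) => s _.
  by apply: RInt_correct; apply: ex_RInt_continuous => z _.
Qed.

Lemma is_derive_at_right (f : R -> R) (D : R) :
  is_derive f 0 D -> filterlim f (at_right 0) (locally (f 0)).
Proof.
  move=> H.
  have Hc : continuous f 0 := ex_derive_continuous f 0 (ex_intro _ D H).
  apply: filterlim_filter_le_1 Hc; exact: filter_le_within.
Qed.

(** The system is solved by quadrature: th l and the r i with i different from l are integrals of
    the kicks, r l is constant and the other angles are linear in time. *)
Lemma ham_flow_exists th r : exists Th Rr, ham_sol ham Th Rr /\ Th 0 = th /\ Rr 0 = r.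
Proof.
  set a := r l.
  pose Th s i := th i + om i * s + (if i == l then RInt (kick_th th a) 0 s else 0).
  pose Rr s i := r i - (if i == l then 0 else RInt (kick_r th a i) 0 s).
  exists Th, Rr.
  have HTh : forall t i, is_derive (fun s => Th s i) t (om i + if i == l then kick_th th a t else 0).
    move=> t i; apply: (is_derive_plus (V := R_NormedModule)).
      by auto_derive => //; ring.
    case: (i == l); last exact: is_derive_const.
    by apply: is_derive_RInt_continuous => s; exact: kick_th_continuous.
  have HRr : forall t i, is_derive (fun s => Rr s i) t (- if i == l then 0 else kick_r th a i t).
    move=> t i; rewrite -[X in is_derive _ _ X]Rplus_0_l.
    apply: (is_derive_minus (V := R_NormedModule)); first exact: is_derive_const.
    case: (i == l); first exact: is_derive_const.
    by apply: is_derive_RInt_continuous => s; exact: kick_r_continuous.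
  split; [split|split].
  - move=> t _ i.
    have Hl : Rr t l = a by rewrite /Rr eqxx Rminus_0_r.
    have Hang : forall n, angle n (Th t) = angle n th + t * speed n.
      by move=> n; apply: angle_flow => j Hj; rewrite /Th (negbTE Hj) Rplus_0_r.
    split.
    + rewrite ham_derive_r // Hl.
      rewrite (Series_ext _ (fun n => eps n * (INR n.+2 * a ^ n.+1) * sin (angle n th + t * speed n)));
        first exact: HTh.
      by move=> n; rewrite Hang.
    + rewrite ham_derive_th // Hl.
      suff -> : Series (fun n => eps n * a ^ n.+2 * (2 * PI * IZR (K n i)) * cos (angle n (Th t)))
          = if i == l then 0 else kick_r th a i t by exact: HRr.
      case: (eqVneq i l) => [->|_]; last by apply: Series_ext => n; rewrite Hang.
      rewrite (Series_ext _ (fun n => 0 * eps n)); first by rewrite Series_scal_l; ring.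
      by move=> n; rewrite K_l; ring.
  - move=> i; split; first exact: is_derive_at_right (HTh 0 i).
    exact: is_derive_at_right (HRr 0 i).
  - apply: functional_extensionality => i; rewrite /Th RInt_point Rmult_0_r.
    by case: (i == l); rewrite /zero /=; ring.
  - apply: functional_extensionality => i; rewrite /Rr RInt_point.
    by case: (i == l); rewrite /zero /=; ring.
Qed.

(** * Displacement of an arbitrary solution *)

Section Growth.
Hypothesis om_K : forall n, dotR om (zvec (K n)) <> 0.
Variables (th r : 'I_d -> R) (Th Rr : R -> 'I_d -> R).
Hypothesis sol : ham_sol ham Th Rr.
Hypothesis Th0 : Th 0 = th.
Hypothesis Rr0 : Rr 0 = r.

(** The angle th l does not occur in the Hamiltonian, so the increment bound applies with M = 0. *)
Lemma sol_r_last t : 0 < t -> Rr t l = r l.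
Proof.
  move=> Ht.
  have H : Rabs (Rr t l - Rr 0 l) <= 0 * t.
    apply: (increment_bound_right (fun s => Rr s l) (fun s => - dth ham l (Th s) (Rr s))) => //.
    - by move=> s Hs; case: (proj1 sol s Hs l).
    - by case: (proj2 sol l).
    - move=> s _; rewrite ham_derive_th //.
      rewrite (Series_ext _ (fun n => 0 * eps n)).
        by rewrite Series_scal_l Rmult_0_l Ropp_0 Rabs_R0; lra.
      by move=> n; rewrite K_l; ring.
  rewrite Rr0 Rmult_0_l in H.
  have := Rabs_pos (Rr t l - r l) => H2.
  have H3 : Rabs (Rr t l - r l) = 0 by lra.
  case: (Req_dec (Rr t l - r l) 0) => [|/Rabs_no_R0 //]; lra.
Qed.

Lemma sol_th t i : 0 < t -> i != l -> Th t i = th i + om i * t.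
Proof.
  move=> Ht Hi.
  have H : Rabs ((Th t i - om i * t) - (Th 0 i - om i * 0)) <= 0 * t.
    apply: (increment_bound_right (fun s => Th s i - om i * s) (fun s => dr ham i (Th s) (Rr s) - om i)) => //.
    - move=> s Hs; apply: (is_derive_minus (V := R_NormedModule)); first by case: (proj1 sol s Hs i).
      by auto_derive => //; ring.
    - apply: (filterlim_comp_2 (G := locally (Th 0 i)) (H := locally (om i * 0)) (fun s => Th s i) (fun s => om i * s) Rminus).
      + by case: (proj2 sol i).
      + apply: (is_derive_at_right (fun s => om i * s) (om i)).
        by auto_derive => //; ring.
      + have E : Th 0 i - om i * 0 = plus (Th 0 i) (opp (om i * 0)) by [].
        apply: (filterlim_comp_2 (fun x => fst x) (fun x => opp (snd x)) plus).
        * exact: filterlim_fst.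
        * apply: filterlim_comp filterlim_snd _; exact: (filterlim_opp (V := R_NormedModule)).
        * exact: (filterlim_plus (V := R_NormedModule)).
    - move=> s _; rewrite ham_derive_r // (negbTE Hi).
      by rewrite Rplus_0_r Rminus_diag_eq // Rabs_R0; lra.
  rewrite Th0 Rmult_0_l in H.
  case: (Req_dec ((Th t i - om i * t) - (th i - om i * 0)) 0) => [|/Rabs_no_R0]; first lra.
  have := Rabs_pos ((Th t i - om i * t) - (th i - om i * 0)); lra.
Qed.

Notation c i n := (kick_coef (r l) i n).

Lemma kick_coef_ex_series i : ex_series (fun n => Rabs (c i n)).
Proof.
  apply: ex_series_dom (ex_series_weight eps K eps_summable (2 * Rabs (r l) + 1) (2 * PI)) => n.
  rewrite Rabs_Rabsolu; exact: kick_coef_le.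
Qed.

(** Adding to r i the antiderivatives of the terms 0, ..., N cancels these terms in the derivative;
    what is left is the tail, which contributes at most its absolute sum times t. Isolating term N
    then leaves the initial value and the earlier terms, each bounded for all times by twice its
    amplitude over its speed. *)
Lemma sol_r_lower_bound t i N : 0 < t ->
  Rabs (c i N / speed N) * Rabs (sin (angle N th + t * speed N) - sin (angle N th))
   <= Rabs (Rr t i) + Rabs (r i) + \big[Rplus/0]_(m < N) (2 * Rabs (c i m / speed m))
     + Series (fun k => Rabs (c i (N.+1 + k)%N)) * t.
Proof.
  move=> Ht.
  have nu0 : forall n, speed n <> 0.
    move=> n; rewrite /speed; have := om_K n; have := PI_RGT_0 => P H1 H2.
    by case/Rmult_integral: H2; lra.
  (* The antiderivative of the m-th cosine term that vanishes at time 0; the division by [speed m]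
     is where the small divisor enters. *)
  pose term m s := c i m / speed m * (sin (angle m th + s * speed m) - sin (angle m th)).
  pose S s := \big[Rplus/0]_(m < N.+1) term m s.
  have HS : forall s, is_derive S s (\big[Rplus/0]_(m < N.+1) (c i m * cos (angle m th + s * speed m))).
    move=> s; apply: is_derive_big => m; rewrite /term.
    auto_derive => //; field; exact: nu0.
  have S0 : S 0 = 0.
    by rewrite /S big1 // => m _; rewrite /term Rmult_0_l Rplus_0_r; ring.
  have Ec := kick_coef_ex_series i.
  have EN : ex_series (fun k => Rabs (c i (N.+1 + k)%N)).
    by apply/(ex_series_incr_n (fun n => Rabs (c i n)) N.+1).
  have H : Rabs ((Rr t i + S t) - (Rr 0 i + S 0)) <= Series (fun k => Rabs (c i (N.+1 + k)%N)) * t.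
    apply: (increment_bound_right (fun s => Rr s i + S s) (fun s => - dth ham i (Th s) (Rr s)
        + \big[Rplus/0]_(m < N.+1) (c i m * cos (angle m th + s * speed m)))) => //.
    - move=> s Hs; apply: (is_derive_plus (V := R_NormedModule)); last exact: HS.
      by case: (proj1 sol s Hs i).
    - apply: (filterlim_comp_2 (G := locally (Rr 0 i)) (H := locally (S 0)) (fun s => Rr s i) S Rplus).
      + by case: (proj2 sol i).
      + exact: is_derive_at_right (HS 0).
      + exact: (filterlim_plus (V := R_NormedModule)).
    - move=> s Hs; rewrite ham_derive_th // sol_r_last //.
      rewrite (Series_ext _ (fun n => c i n * cos (angle n th + s * speed n))); last first.
        move=> n; rewrite (angle_flow n th _ s) // => j Hj; exact: sol_th.
      have cd : forall n, Rabs (c i n * cos (angle n th + s * speed n)) <= Rabs (c i n).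
        move=> n; rewrite Rabs_mult -[X in _ <= X]Rmult_1_r.
        by apply: Rmult_le_compat_l; [exact: Rabs_pos|exact: Rabs_cos_le1].
      rewrite (Series_tail _ N.+1); last exact: ex_series_dom Ec.
      set X := \big[_/_]_(_ < _) _; set Y := Series _.
      have -> : - (X + Y) + X = - Y by ring.
      by rewrite Rabs_Ropp; apply: Series_dom EN => k.
  rewrite S0 Rr0 Rplus_0_r in H.
  have ES : S t = \big[Rplus/0]_(m < N) term m t + term N t by rewrite /S big_ord_recr.
  have HB : Rabs (\big[Rplus/0]_(m < N) term m t) <= \big[Rplus/0]_(m < N) (2 * Rabs (c i m / speed m)).
    elim/big_rec2: _ => [|m x y _ IH]; first by rewrite Rabs_R0; lra.
    apply: Rle_trans (Rabs_triang _ _) _; apply: Rplus_le_compat => //.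
    rewrite /term Rabs_mult Rmult_comm; apply: Rmult_le_compat_r; first exact: Rabs_pos.
    apply: Rle_trans (Rabs_triang _ _) _; rewrite Rabs_Ropp.
    have := Rabs_sin_le1 (angle m th + t * speed m); have := Rabs_sin_le1 (angle m th); lra.
  rewrite -Rabs_mult -/(term N t).
  have -> : term N t = (Rr t i + S t - r i) + (- Rr t i) + r i + - \big[Rplus/0]_(m < N) term m t.
    by rewrite ES; ring.
  apply: Rle_trans (Rabs_triang _ _) _; rewrite Rabs_Ropp.
  have A1 := Rabs_triang (Rr t i + S t - r i + - Rr t i) (r i).
  have A2 := Rabs_triang (Rr t i + S t - r i) (- Rr t i); rewrite Rabs_Ropp in A2.
  lra.
Qed.

End Growth.
End Flow.

(** * Growth along lacunary small divisors *)

(** Once n exceeds A + 1 the exponent (A - n) W n is at most - W n, hence at most - n, and a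
    geometric series dominates. *)
Lemma ex_series_superexp (W : nat -> R) (A : R) : (forall n, INR n + 1 <= W n) ->
  ex_series (fun n => exp (- INR n * W n) * exp (A * W n)).
Proof.
  move=> HW; have [N HN] := INR_unbounded (A + 1).
  apply/(ex_series_incr_n _ N).
  apply: (ex_series_dom _ (fun k => (exp (-1)) ^ k)); last first.
    apply: ex_series_geom; rewrite Rabs_pos_eq; last exact: Rlt_le (exp_pos _).
    by rewrite -exp_0; apply: exp_increasing; lra.
  move=> k; rewrite Rabs_pos_eq -exp_plus; last exact: Rlt_le (exp_pos _).
  have -> : exp (-1) ^ k = exp (- INR k).
    elim: (k) => [|m IH]; first by rewrite /= Ropp_0 exp_0.
    by rewrite S_INR /= IH -exp_plus; congr exp; ring.
  apply: exp_le_mono.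
  have := HW (N + k)%N; have -> : INR (N + k)%N = INR N + INR k by exact: plus_INR.
  move: (W _) (pos_INR k) (pos_INR N) => V k0 N0 HV.
  have : 0 <= (INR N + INR k - A - 1) * V by apply: Rmult_le_pos; lra.
  lra.
Qed.

(** Phase shifts by 5 PI / 2 and 7 PI / 2 turn sin phi into plus and minus cos phi, in an order
    depending on the sign of nu, and one of the two is far enough from sin phi. Both shifts lie in
    [2 PI, 4 PI]: the lower bound forces late times when nu is small, the upper one limits the drift
    caused by later terms. *)
Lemma sin_swing (phi nu : R) : nu <> 0 ->
  exists t, [/\ 0 < t, 2 * PI <= t * Rabs nu, t * Rabs nu <= 4 * PI & 1 <= Rabs (sin (phi + t * nu) - sin phi)].
Proof.
  move=> Hnu; have P := PI_RGT_0; have An := Rabs_pos_lt _ Hnu.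
  have per : forall x, sin (x + 2 * PI) = sin x /\ sin (x - 2 * PI) = sin x.
    move=> x; split; first by rewrite sin_plus cos_2PI sin_2PI; ring.
    by rewrite sin_minus cos_2PI sin_2PI; ring.
  have ex : exists x, (x = 5 * (PI / 2) \/ x = 7 * (PI / 2)) /\
      1 <= Rabs (sin (phi + x * (nu / Rabs nu)) - sin phi).
    have Hs : nu / Rabs nu = 1 \/ nu / Rabs nu = -1.
      case: (Rle_lt_dec 0 nu) => H; [left; rewrite Rabs_pos_eq | right; rewrite Rabs_left] => //; by field.
    have E1 : sin (phi + 5 * (PI / 2) * (nu / Rabs nu)) = (nu / Rabs nu) * cos phi.
      case: Hs => ->.
      - have -> : phi + 5 * (PI / 2) * 1 = (phi + PI / 2) + 2 * PI by field.
        by rewrite (proj1 (per _)) sin_plus cos_PI2 sin_PI2; ring.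
      - have -> : phi + 5 * (PI / 2) * -1 = (phi - PI / 2) - 2 * PI by field.
        by rewrite (proj2 (per _)) sin_minus cos_PI2 sin_PI2; ring.
    have E2 : sin (phi + 7 * (PI / 2) * (nu / Rabs nu)) = - (nu / Rabs nu) * cos phi.
      case: Hs => ->.
      - have -> : phi + 7 * (PI / 2) * 1 = (phi - PI / 2 + 2 * PI) + 2 * PI by field.
        by rewrite !(proj1 (per _)) sin_minus cos_PI2 sin_PI2; ring.
      - have -> : phi + 7 * (PI / 2) * -1 = (phi + PI / 2 - 2 * PI) - 2 * PI by field.
        by rewrite !(proj2 (per _)) sin_plus cos_PI2 sin_PI2; ring.
    have sq : forall x y, 1 <= (x - y) ^ 2 -> 1 <= Rabs (x - y).
      by move=> x y; rewrite -pow2_abs => H; have := Rabs_pos (x - y); nra.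
    have sc := sin2_cos2 phi; rewrite /Rsqr in sc.
    set sg := nu / Rabs nu in Hs E1 E2 *.
    have sg2 : sg * sg = 1 by case: Hs => ->; ring.
    (* [(sg c - s)^2 + (- sg c - s)^2 = 2], so one of the two squares is at least 1 *)
    case: (Rle_dec 1 ((sg * cos phi - sin phi) ^ 2)) => H.
    - by exists (5 * (PI / 2)); split; [left | rewrite E1; apply: sq].
    - exists (7 * (PI / 2)); split; [by right | rewrite E2; apply: sq].
      have -> : (- sg * cos phi - sin phi) ^ 2 =
        2 * (sg * sg * (cos phi * cos phi) + sin phi * sin phi) - (sg * cos phi - sin phi) ^ 2 by ring.
      rewrite sg2; lra.
  case: ex => x [Hx H]; exists (x / Rabs nu).
  have E : x / Rabs nu * Rabs nu = x by field; lra.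
  split.
  - by apply: Rdiv_lt_0_compat => //; case: Hx => ->; lra.
  - by rewrite E; case: Hx => ->; lra.
  - by rewrite E; case: Hx => ->; lra.
  - by have -> : x / Rabs nu * nu = x * (nu / Rabs nu) by field; lra.
Qed.

Section Unbounded.
Context {d : nat} (om : 'I_d -> R) (l : 'I_d) (eps : nat -> R) (K : nat -> 'I_d -> Z).
Notation weight n := (INR n + 1 + l1norm (zvec (K n))).
Hypothesis eps_gt0 : forall n, 0 < eps n.
Hypothesis eps_sqr : forall n, eps n ^ 2 = Rabs (dotR om (zvec (K n))).
Hypothesis eps_small : forall n, eps n <= exp (- INR n * weight n).
(** Used in two directions. With n = N it bounds every earlier 1 / eps m ^ 2 by exp (- N * weight N)
    / eps N; with m = N it makes the later amplitudes small against eps N ^ 2, the inverse of the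
    time scale of term N. *)
Hypothesis eps_lacunary : forall m n, (m < n)%N -> eps n <= exp (- INR n * weight n) * eps m ^ 2.
Hypothesis K_l : forall n, K n l = 0%Z.
Hypothesis K_neq0 : forall n, exists i, 1 <= Rabs (IZR (K n i)).

Lemma lacunary_summable A : ex_series (fun n => eps n * exp (A * weight n)).
Proof.
  apply: (ex_series_dom _ (fun n => exp (- INR n * weight n) * exp (A * weight n))).
    move=> n; have e0 := exp_pos (A * weight n); have := eps_gt0 n.
    rewrite Rabs_pos_eq; last by have := eps_gt0 n; nra.
    by move=> _; apply: Rmult_le_compat_r; [lra|exact: eps_small].
  apply: (ex_series_superexp (fun n => weight n)) => n; have := weight_ge K n; lra.
Qed.

Lemma lacunary_dot_neq0 n : dotR om (zvec (K n)) <> 0.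
Proof.
  move=> H; have := eps_sqr n; rewrite H Rabs_R0; have := eps_gt0 n => H1.
  by have := pow_lt _ 2 H1; lra.
Qed.

(** With e = eps N and q = exp (- N * weight N), everything is compared with q / e >= 1: term N
    contributes at least (N + 1) q / e, the earlier terms at most 2 Y q / e, and the later ones at
    most 4 PI Z, where Y and Z depend on neither N nor t. A large N therefore wins. *)
Lemma sol_unbounded (th r : 'I_d -> R) (Th Rr : R -> 'I_d -> R) :
  r l <> 0 -> ham_sol (ham om l eps K) Th Rr -> Th 0 = th -> Rr 0 = r ->
  forall M T, exists t, T <= t /\ M < supnorm (Rr t).
Proof.
  move=> rl sol Th0 Rr0 M T; have P := PI_RGT_0.
  have eps_ge0 : forall n, 0 <= eps n by move=> n; apply: Rlt_le.
  set x := Rabs (r l); have x0 : 0 < x by exact: Rabs_pos_lt.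
  set A := 2 * x + 1.
  set Yn := fun n => eps n * exp (A * weight n).
  set Zn := fun n => exp (- INR n * weight n) * exp (A * weight n).
  have HY : ex_series Yn by exact: lacunary_summable.
  have HZ : ex_series Zn.
    by apply: (ex_series_superexp (fun n => weight n)) => n; have := weight_ge K n; lra.
  have Yn0 : forall n, 0 <= Yn n.
    by move=> n; apply: Rmult_le_pos => //; exact: Rlt_le (exp_pos _).
  have Zn0 : forall n, 0 <= Zn n.
    by move=> n; apply: Rmult_le_pos; exact: Rlt_le (exp_pos _).
  have tail0 : forall u N, (forall n, 0 <= u n) -> ex_series u -> 0 <= Series (fun k => u (N + k)%N).
    move=> u N Hu He; apply: Rle_trans (Rabs_pos _) (Series_dom (fun k => u (N + k)%N) (fun k => u (N + k)%N) _ _).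
      by move=> k; rewrite Rabs_pos_eq; [lra|].
    by apply/(ex_series_incr_n u N).
  set Y := Series Yn; set Z := Series Zn.
  have Y0 : 0 <= Y by exact: (tail0 Yn 0%N).
  have Z0 : 0 <= Z by exact: (tail0 Zn 0%N).
  set B := Rabs (ln x); have B0 : 0 <= B by exact: Rabs_pos.
  have s0 : 0 <= supnorm r by apply: Rle_trans (Rabs_pos _) (Rabs_le_supnorm r l).
  (* 3 B ensures that a small |r l| cannot spoil the main term, 4 Y lets half of n pay for the
     earlier terms, the doubled bracket is paid by the other half since q / e >= 1, and |T| makes
     the time late enough. *)
  have [N HN] := INR_unbounded (3 * B + 4 * Y + 2 * (Rabs M + supnorm r + 4 * PI * Z) + Rabs T + 1).
  have M0 := Rabs_pos M; have T0 := Rabs_pos T.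
  have PZ : 0 <= PI * Z by apply: Rmult_le_pos; lra.
  set n := INR N in HN; have n1 : 1 <= n by lra.
  set e := eps N; set q := exp (- n * weight N).
  have e0 : 0 < e := eps_gt0 N.
  have eq : e <= q := eps_small N.
  have q0 : 0 < q := exp_pos _.
  have Wn : n + 1 <= weight N by have := weight_ge K N; rewrite -/n; lra.
  have q1 : q <= exp (- n) by apply: exp_le_mono; nra.
  have en1 : exp (- n) <= 1 by rewrite -exp_0; apply: exp_le_mono; lra.
  have ennn : exp n * exp (- n) = 1 by rewrite -exp_plus Rplus_opp_r exp_0.
  have en : n + 1 <= exp n by have := exp_ineq1_le n; lra.
  (* In exponents: n - n * weight N <= - n^2 <= - (n + 2) B <= (n + 2) ln x, using weight N >= n + 1
     and n >= 3 B with n >= 1. *)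
  have HP : exp n * q <= x ^ N.+2.
    have -> : x ^ N.+2 = exp (INR N.+2 * ln x).
      rewrite -[in LHS](exp_ln x) //.
      elim: (N.+2) => [|m IH]; first by rewrite /= Rmult_0_l exp_0.
      by rewrite S_INR /= IH -exp_plus; congr exp; ring.
    rewrite /q -exp_plus; apply: exp_le_mono; rewrite !S_INR -/n.
    have : - B <= ln x by have := Rle_abs (- ln x); rewrite Rabs_Ropp -/B; lra.
    have B3 : 3 * B <= n by lra.
    move=> Hln.
    have A1 : n * (n + 1) <= n * weight N by apply: Rmult_le_compat_l; lra.
    rewrite -/n in A1.
    have A2 : (n + 1 + 1) * - B <= (n + 1 + 1) * ln x by apply: Rmult_le_compat_l; lra.
    have A3 : n * (3 * B) <= n * n by apply: Rmult_le_compat_l; lra.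
    have A4 : (n + 1 + 1) * B <= 3 * n * B by apply: Rmult_le_compat_r; lra.
    lra.
  have [i Hi] := K_neq0 N.
  set nu := speed om K.
  have nuE : forall m, Rabs (nu m) = 2 * PI * eps m ^ 2.
    by move=> m; rewrite /nu /speed Rabs_mult Rabs_pos_eq ?eps_sqr //; lra.
  have nu0 : forall m, nu m <> 0.
    move=> m H; have := nuE m; rewrite H Rabs_R0 => H2.
    by have := pow_lt _ 2 (eps_gt0 m); nra.
  have [t [t0 tl tu Hsw]] := sin_swing (angle K N th) (nu N) (nu0 N).
  rewrite nuE -/e in tl tu.
  have De : 0 < e ^ 2 by exact: pow_lt.
  (* Since |nu N| = 2 PI e^2, the window [2 PI, 4 PI] of [sin_swing] becomes 1 <= t e^2 <= 2. The
     left half also gives t >= exp n, hence t >= T. *)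
  have t1 : 1 <= t * e ^ 2.
    by apply: (Rmult_le_reg_l (2 * PI)); lra.
  have t2 : t * e ^ 2 <= 2.
    by apply: (Rmult_le_reg_l (2 * PI)); lra.
  exists t; split.
    apply: Rle_trans (Rle_abs T) _.
    have e2 : e ^ 2 <= exp (- n).
      have -> : e ^ 2 = e * e by ring.
      have : e <= exp (- n) by lra.
      nra.
    have : exp n * (t * e ^ 2) <= t.
      apply: Rle_trans (_ : exp n * (t * exp (- n)) <= _).
        apply: Rmult_le_compat_l; first exact: Rlt_le (exp_pos _).
        by apply: Rmult_le_compat_l => //; lra.
      have -> : exp n * (t * exp (- n)) = t * (exp n * exp (- n)) by ring.
      by rewrite ennn; lra.
    nra.
  have cY : forall m, Rabs (kick_coef eps K (r l) i m / nu m) <= Yn m / eps m ^ 2.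
    move=> m; have em := pow_lt _ 2 (eps_gt0 m).
    rewrite /Rdiv Rabs_mult Rabs_inv nuE.
    have H := kick_coef_le eps K eps_ge0 (r l) i m.
    apply: Rle_trans (_ : 2 * PI * Yn m * / (2 * PI * eps m ^ 2) <= _).
      apply: Rmult_le_compat_r; last exact: H.
      by apply: Rlt_le; apply: Rinv_0_lt_compat; apply: Rmult_lt_0_compat; lra.
    by apply: Req_le; field; split; have := eps_gt0 m; lra.
  (* Each earlier amplitude over speed is at most Yn m / eps m ^ 2, and lacunarity replaces 1 / eps
     m ^ 2 by q / e, uniformly in m. *)
  have early : \big[Rplus/0]_(m < N) (2 * Rabs (kick_coef eps K (r l) i m / nu m)) <= 2 * (q / e) * Y.
    have HYN : \big[Rplus/0]_(m < N) Yn m <= Y.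
      by rewrite /Y (Series_tail Yn N HY); have := tail0 Yn N Yn0 HY; lra.
    apply: Rle_trans (_ : 2 * (q / e) * \big[Rplus/0]_(m < N) Yn m <= _); last first.
      apply: Rmult_le_compat_l HYN; apply: Rmult_le_pos; first lra.
      by apply: Rlt_le; exact: Rdiv_lt_0_compat.
    elim/big_rec2: _ => [|m a b _ IH]; first lra.
    rewrite Rmult_plus_distr_l; apply: Rplus_le_compat => //.
    have -> : 2 * (q / e) * Yn m = 2 * (Yn m * (q / e)) by ring.
    apply: Rmult_le_compat_l; first lra.
    apply: Rle_trans (cY m) _; apply: Rmult_le_compat_l => //.
    have em := pow_lt _ 2 (eps_gt0 m).
    have := eps_lacunary m N (ltn_ord m); rewrite -/e -/n -/q => H.
    apply: (Rmult_le_reg_r (eps m ^ 2 * e)); first exact: Rmult_lt_0_compat.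
    have -> : / eps m ^ 2 * (eps m ^ 2 * e) = e by field; have := eps_gt0 m; lra.
    have -> : q / e * (eps m ^ 2 * e) = q * eps m ^ 2 by field; lra.
    done.
  (* The factor e^2 taken out by lacunarity is what compensates the time t <= 2 / e^2 later on. *)
  have late : Series (fun k => Rabs (kick_coef eps K (r l) i (N.+1 + k)%N)) <= 2 * PI * e ^ 2 * Z.
    have HZN : ex_series (fun k => Zn (N.+1 + k)%N) by apply/(ex_series_incr_n Zn N.+1).
    have Zle : Series (fun k => Zn (N.+1 + k)%N) <= Z.
      rewrite /Z (Series_tail Zn N.+1 HZ).
      have : 0 <= \big[Rplus/0]_(m < N.+1) Zn m by exact: sumR_ge0.
      lra.
    apply: Rle_trans (_ : Series (fun k => 2 * PI * e ^ 2 * Zn (N.+1 + k)%N) <= _); last first.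
      by rewrite Series_scal_l; apply: Rmult_le_compat_l Zle; apply: Rmult_le_pos; lra.
    apply: Series_le; last exact: (ex_series_scal_l (V := R_NormedModule)).
    move=> k; split; first exact: Rabs_pos.
    apply: Rle_trans (kick_coef_le eps K eps_ge0 (r l) i _) _.
    rewrite (Rmult_assoc (2 * PI)); apply: Rmult_le_compat_l; first lra.
    rewrite /Zn -Rmult_assoc; apply: Rmult_le_compat_r; first exact: Rlt_le (exp_pos _).
    have := eps_lacunary N (N.+1 + k)%N; rewrite -/e => H.
    by rewrite Rmult_comm; apply: H; rewrite addSn ltnS leq_addr.
  have main : x ^ N.+2 / e <= Rabs (kick_coef eps K (r l) i N / nu N).
    rewrite /kick_coef -/e /Rdiv Rabs_mult Rabs_inv nuE -/e.
    have xp : 0 <= x ^ N.+2 by apply: pow_le; lra.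
    have -> : Rabs (e * r l ^ N.+2 * (2 * PI * IZR (K N i))) = e * x ^ N.+2 * (2 * PI * Rabs (IZR (K N i))).
      rewrite Rabs_mult (Rabs_mult e) -RPow_abs -/x (Rabs_pos_eq e); last lra.
      by rewrite Rabs_mult (Rabs_pos_eq (2 * PI)) //; lra.
    have -> : e * x ^ N.+2 * (2 * PI * Rabs (IZR (K N i))) * / (2 * PI * e ^ 2)
        = (x ^ N.+2 * / e) * Rabs (IZR (K N i)) by field; lra.
    rewrite -[X in X <= _]Rmult_1_r; apply: Rmult_le_compat_l => //.
    by apply: Rmult_le_pos => //; apply: Rlt_le; exact: Rinv_0_lt_compat.
  have := sol_r_lower_bound om l eps K eps_ge0 lacunary_summable K_l lacunary_dot_neq0
            th r Th Rr sol Th0 Rr0 t i N t0.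
  rewrite -/nu => H.
  have H1 : x ^ N.+2 / e <= Rabs (Rr t i) + Rabs (r i) + 2 * (q / e) * Y + 4 * PI * Z.
    have L1 : Rabs (kick_coef eps K (r l) i N / nu N) <= Rabs (kick_coef eps K (r l) i N / nu N)
         * Rabs (sin (angle K N th + t * nu N) - sin (angle K N th)).
      rewrite -[X in X <= _]Rmult_1_r; apply: Rmult_le_compat_l => //; exact: Rabs_pos.
    have L2 : Series (fun k => Rabs (kick_coef eps K (r l) i (N.+1 + k)%N)) * t <= 4 * PI * Z.
      apply: Rle_trans (Rmult_le_compat_r _ _ _ (Rlt_le _ _ t0) late) _.
      have -> : 2 * PI * e ^ 2 * Z * t = 2 * (PI * Z) * (t * e ^ 2) by ring.
      nra.
    lra.
  have qe : 1 <= q / e.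
    by apply: (Rmult_le_reg_r e) => //; rewrite /Rdiv Rmult_assoc Rinv_l; lra.
  have H2 : (n + 1) * (q / e) <= x ^ N.+2 / e.
    have -> : (n + 1) * (q / e) = ((n + 1) * q) / e by field; lra.
    apply: Rmult_le_compat_r; first by apply: Rlt_le; exact: Rinv_0_lt_compat.
    nra.
  apply: Rlt_le_trans (Rabs_le_supnorm (Rr t) i).
  have H3 := Rabs_le_supnorm r i.
  have H4 := Rle_abs M.
  have H5 : 0 <= (n / 2 - 2 * Y) * (q / e) by apply: Rmult_le_pos; lra.
  have H6 : 0 <= (n / 2 + 1) * (q / e - 1) by apply: Rmult_le_pos; lra.
  lra.
Qed.

End Unbounded.

(** * Extraction of lacunary small divisors from the Liouville condition *)

Lemma l1norm_le_supnorm (d : nat) (v : 'I_d -> R) : l1norm v <= INR d * supnorm v.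
Proof.
  rewrite /l1norm; have H := Rabs_le_supnorm v.
  move: (supnorm v) H => s H.
  apply: Rle_trans (_ : \big[Rplus/0]_(i < d) s <= _).
    by elim/big_rec2: _ => [|i a b _ IH]; [lra|have := H i; lra].
  rewrite big_const_ord; elim: (d) => [|k IH]; first by rewrite /=; lra.
  rewrite S_INR iterS; lra.
Qed.

Lemma supnorm_gt0_ex (d : nat) (k : 'I_d -> Z) : 0 < znorm k -> exists i, 1 <= Rabs (IZR (k i)).
Proof.
  move=> H; case: (altP (@existsP _ (fun i => ~~ Z.eqb (k i) 0))) => [[i Hi]|].
    exists i; rewrite -abs_IZR; apply: IZR_le.
    by move/negP: Hi => Hi; have : k i <> 0%Z by [move=> E; apply: Hi; rewrite E]; lia.
  rewrite negb_exists => /forallP H0.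
  suff : znorm k = 0 by lra.
  rewrite /znorm /supnorm; elim/big_rec: _ => // i a _ ->.
  have := H0 i; rewrite negbK => /Z.eqb_eq Ek.
  by rewrite /zvec Ek Rabs_R0 Rmax_left //; lra.
Qed.

(** A far enough member of the given sequence, extended by a zero last coordinate. This extension
    changes neither the product with the frequency vector nor the l1 norm. *)
Lemma liouville_select (n : nat) (om : 'I_n.+1 -> R) : liouville_seq (vtilde om) ->
  forall M, 0 <= M -> exists k : 'I_n.+1 -> Z,
    [/\ k ord_max = 0%Z, exists i, 1 <= Rabs (IZR (k i)),
        0 < Rabs (dotR om (zvec k)) & Rabs (dotR om (zvec k)) <= exp (- M * l1norm (zvec k))].
Proof.
  case=> kbar /is_lim_seq_spec Hlim M HM.
  (* The factor n converts the sup norm of the Liouville condition into the l1 norm; the extra -1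
     makes the ratio strictly negative, which rules out the degenerate cases below. *)
  case: (Hlim (- (M * INR n) - 1)) => N HN.
  have {HN Hlim} := HN N (le_n N); move: (kbar N) => k0 /= H.
  set D := Rabs (dotR _ _) in H; set s := znorm k0 in H.
  have MN : 0 <= M * INR n by apply: Rmult_le_pos => //; exact: pos_INR.
  have s0 : 0 <= s.
    rewrite /s /znorm /supnorm; elim/big_rec: _ => [|i a _ Ha]; first lra.
    exact: Rle_trans Ha (Rmax_r _ _).
  (* Division by 0 yields 0, so a zero vector would give the ratio 0. *)
  have sp : 0 < s.
    case: s0 => // E; move: H; rewrite -E /Rdiv Rinv_0 Rmult_0_r; lra.
  have lnD : ln D <= - (M * INR n) * s - s.
    have -> : ln D = ln D / s * s by field; lra.
    nra.
  (* [ln] is 0 off the positive reals, which contradicts the negative bound on ln D. *)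
  have Dp : 0 < D.
    case: (Rlt_dec 0 D) => // HD; move: lnD.
    have -> : ln D = 0 by rewrite /ln; case: Rlt_dec.
    nra.
  have [i0 Hi0] := supnorm_gt0_ex _ k0 sp.
  pose k (i : 'I_n.+1) : Z := if unlift ord_max i is Some j then k0 j else 0%Z.
  have kmax : k ord_max = 0%Z by rewrite /k unlift_none.
  have klift : forall j : 'I_n, k (widen_ord (leq_pred n.+1) j) = k0 j.
    move=> j; have -> : widen_ord (leq_pred n.+1) j = lift ord_max j.
      by apply: val_inj; rewrite /= /bump leqNgt ltn_ord.
    by rewrite /k liftK.
  have wE : forall j : 'I_n, widen_ord (leqnSn n) j = widen_ord (leq_pred n.+1) j by move=> j; apply: val_inj.
  have Edot : dotR om (zvec k) = dotR (vtilde om) (zvec k0).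
    rewrite /dotR big_ord_recr /= {2}/zvec kmax Rmult_0_r Rplus_0_r.
    by apply: eq_bigr => j _; rewrite /vtilde /zvec wE klift.
  have El1 : l1norm (zvec k) = l1norm (zvec k0).
    rewrite /l1norm big_ord_recr /= {2}/zvec kmax Rabs_R0 Rplus_0_r.
    by apply: eq_bigr => j _; rewrite /zvec wE klift.
  exists k; split => //.
  - by exists (widen_ord (leq_pred n.+1) i0); rewrite klift.
  - by rewrite Edot.
  - rewrite Edot El1 -/D -(exp_ln D Dp); apply: exp_le_mono.
    have := l1norm_le_supnorm _ (zvec k0); rewrite -/(znorm k0) -/s => H1.
    have : M * l1norm (zvec k0) <= M * (INR n * s) by apply: Rmult_le_compat_l.
    lra.
Qed.

(** A recursive choice in which only the last value of eps^2 has to be remembered: these values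
    decrease, so smallness relative to the previous one implies smallness relative to all earlier
    ones. *)
Lemma lacunary_sequence (d : nat) (om : 'I_d -> R) (l : 'I_d) :
  (forall M, 0 <= M -> exists k : 'I_d -> Z,
    [/\ k l = 0%Z, exists i, 1 <= Rabs (IZR (k i)),
        0 < Rabs (dotR om (zvec k)) & Rabs (dotR om (zvec k)) <= exp (- M * l1norm (zvec k))]) ->
  exists (eps : nat -> R) (K : nat -> 'I_d -> Z),
    [/\ forall n, 0 < eps n,
        forall n, eps n ^ 2 = Rabs (dotR om (zvec (K n))),
        forall n, eps n <= exp (- INR n * (INR n + 1 + l1norm (zvec (K n)))),
        forall m n, (m < n)%N ->
          eps n <= exp (- INR n * (INR n + 1 + l1norm (zvec (K n)))) * eps m ^ 2 &
        (forall n, K n l = 0%Z) /\ forall n, exists i, 1 <= Rabs (IZR (K n i))].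
Proof.
  move=> Hsel.
  pose e (k : 'I_d -> Z) := sqrt (Rabs (dotR om (zvec k))).
  pose good (n : nat) (p : R) (k : 'I_d -> Z) :=
    [/\ k l = 0%Z, exists i, 1 <= Rabs (IZR (k i)), 0 < Rabs (dotR om (zvec k)) &
        e k <= exp (- INR n * (INR n + 1 + l1norm (zvec k))) * p].
  (* The condition 0 < p stands inside the existential so that the choice function is total in p. *)
  have Hgood : forall n p, exists k, 0 < p -> good n p k.
    move=> n p.
    (* As K is nonzero its l1 norm L is at least 1, so M L dominates n (n + 1 + L) - ln p. The
       selection is made with 2 M because [e] is a square root. *)
    set M := INR n + INR n * (INR n + 1) + Rabs (ln p).
    have n0 := pos_INR n; have lp := Rabs_pos (ln p).
    have M0 : 0 <= M by rewrite /M; nra.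
    have [|k [k1 [i Hi] k3 k4]] := Hsel (2 * M); first lra.
    exists k => Hp; split => //; first by exists i.
    have L1 : 1 <= l1norm (zvec k) by exact: Rle_trans Hi (Rabs_le_l1norm (zvec k) i).
    apply: Rle_trans (_ : exp (- M * l1norm (zvec k)) <= _).
      rewrite /e -(sqrt_Rsqr (exp (- M * _))); last exact: Rlt_le (exp_pos _).
      apply: sqrt_le_1_alt; apply: Rle_trans k4 _; rewrite /Rsqr -exp_plus.
      by apply: exp_le_mono; lra.
    rewrite -[X in _ <= _ * X](exp_ln p Hp) -exp_plus; apply: exp_le_mono.
    have : - Rabs (ln p) <= ln p by have := Rle_abs (- ln p); rewrite Rabs_Ropp; lra.
    rewrite /M; move: (l1norm _) L1 => L L1.
    have : INR n * (INR n + 1) + Rabs (ln p) <= (INR n * (INR n + 1) + Rabs (ln p)) * L by nra.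
    nra.
  have [sel Hs] : exists sel : nat -> R -> 'I_d -> Z, forall n p, 0 < p -> good n p (sel n p).
    exists (fun n p => proj1_sig (constructive_indefinite_description _ (Hgood n p))) => n p.
    exact: (proj2_sig (constructive_indefinite_description _ (Hgood n p))).
  (* [ps n] is the square of eps at index n - 1, started with 1; stage n chooses its vector small
     relative to it. *)
  pose fix ps (n : nat) : R := if n is m.+1 then Rabs (dotR om (zvec (sel m (ps m)))) else 1.
  have ps0 : forall n, 0 < ps n.
    elim=> [|n IH] /=; first lra.
    by case: (Hs n (ps n) IH).
  pose K n := sel n (ps n).
  have HK : forall n, good n (ps n) (K n) by move=> n; exact: Hs.
  have esq : forall n, e (K n) ^ 2 = ps n.+1.
    by move=> n; rewrite /e pow2_sqrt //; exact: Rabs_pos.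
  have ex1 : forall n, exp (- INR n * (INR n + 1 + l1norm (zvec (K n)))) <= 1.
    move=> n; rewrite -[X in _ <= X]exp_0; apply: exp_le_mono.
    have n0 := pos_INR n; have L0 := l1norm_ge0 (zvec (K n)).
    have : 0 <= INR n * (INR n + 1 + l1norm (zvec (K n))) by apply: Rmult_le_pos; lra.
    lra.
  have ee : forall n, e (K n) <= ps n.
    move=> n; case: (HK n) => _ _ _ H; apply: Rle_trans H _.
    by rewrite -[X in _ <= X]Rmult_1_l; apply: Rmult_le_compat_r => //; exact: Rlt_le (ps0 n).
  have e0 : forall n, 0 < e (K n) by move=> n; case: (HK n) => _ _ H _; exact: sqrt_lt_R0.
  have ps1 : forall n, ps n <= 1.
    elim=> [|n IH]; first by rewrite /=; lra.
    by rewrite -esq; have := ee n; have := e0 n; nra.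
  (* ps (n + 1) = eps n ^ 2 <= eps n <= ps n. For m < n this gives ps n <= ps (m + 1) = eps m ^ 2,
     which is the required lacunarity. *)
  have psd : forall m n, (m <= n)%N -> ps n <= ps m.
    move=> m n /subnK <-; elim: (n - m)%N => [|k IH]; first by rewrite add0n; lra.
    apply: Rle_trans IH; rewrite addSn -esq.
    have := ee (k + m)%N; have := e0 (k + m)%N; have := ps1 (k + m)%N; nra.
  exists (fun n => e (K n)), K; split => //.
  - move=> n; case: (HK n) => _ _ _ H; apply: Rle_trans H _.
    by rewrite -[X in _ <= X]Rmult_1_r; apply: Rmult_le_compat_l => //; exact: Rlt_le (exp_pos _).
  - move=> m n Hmn; case: (HK n) => _ _ _ H; apply: Rle_trans H _.
    apply: Rmult_le_compat_l; first exact: Rlt_le (exp_pos _).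
    by rewrite esq; exact: psd.
  - by split=> n; case: (HK n).
Qed.

Theorem theoremG (d : nat) (w : 'I_d -> R) :
  (3 <= d)%N ->
  nonresonant w ->
  liouville_seq (vtilde w) ->
  exists H : ('I_d -> R) -> ('I_d -> R) -> R,
    real_entire H /\
    (* H(theta, r) = <omega, r> + O(r^2) *)
    (forall th, bigO_at0 (fun r => H th r - dotR w r) 2) /\
    (* for r_d <> 0 the flow exists for all t >= 0 and
       limsup_{t -> oo} |Phi^t_H(theta, r)| = oo *)
    (forall th r, lastc r <> 0 ->
       (exists Th Rr, ham_sol H Th Rr /\ Th 0 = th /\ Rr 0 = r) /\
       (forall Th Rr, ham_sol H Th Rr -> Th 0 = th -> Rr 0 = r ->
          forall M T, exists t, T <= t /\ M < supnorm (Rr t))) /\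
    (* the Birkhoff normal form of H at T^d x {0} is N(r) = <omega, r> *)
    is_BNF H (fun r => dotR w r).
Proof.
  case: d w => [//|n] w _ _ Hw.
  have [eps [K [H1 H2 H3 H4 [H5 H6]]]] := lacunary_sequence _ w ord_max (liouville_select _ w Hw).
  have eps_ge0 : forall n, 0 <= eps n by move=> m; apply: Rlt_le.
  have Hsum := lacunary_summable eps K H1 H3.
  have lastE : forall r : 'I_n.+1 -> R, lastc r = r ord_max.
    move=> r; rewrite /lastc; case: insubP => [i _ Ei|]; last by rewrite ltnSn.
    by congr r; apply: val_inj.
  exists (ham w ord_max eps K); split; [|split; [|split]].
  - exact: ham_entire.
  - exact: ham_bigO.
  - move=> th r; rewrite lastE => Hr; split; first exact: ham_flow_exists.
    move=> Th Rr sol Th0 Rr0.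
    exact: (sol_unbounded w ord_max eps K H1 H2 H3 H4 H5 H6 th r Th Rr).
  - apply: ham_BNF => //; exact: (lacunary_dot_neq0 w eps K H1 H2).
Qed.
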